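(* Let $1/2<\delta<1$ and $0<\rho<1$ be given. For each $d\in\mathbb{N}$ let $k=k(d)$ and $N=N(d)$ be integers with $0\le k<d<N-1$, such that $$\frac{d}{N}\to\delta,\qquad \frac{k}{d}\to\rho\qquad\text{as } d\to\infty.$$ For each $d$, let $\phi=\phi_d$ be a probability measure on $\mathbb{R}^{N-d-1}$ that is even (invariant under $x\mapsto -x$) and assigns measure zero to every hyperplane through the origin $o$. Let $G_{d,N}$ denote the (random class of combinatorially equivalent) polytope(s) in $\mathbb{R}^d$ associated with a $(\phi,N)$ random Gale diagram, and let $f_k(G_{d,N})$ be the number of its $k$-dimensional faces. If $\rho<\rho_S(\delta)$, then $$\lim_{d\to\infty}\mathbb{P}\left(f_k(G_{d,N})=\binom{N}{k+1}\right)=1.$$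
   Context: **Gale transform.** Let $(a_1,\dots,a_N)$ be a sequence of points affinely spanning $\mathbb{R}^d$. The space of affine dependences, i.e. of $(\lambda_1,\dots,\lambda_N)\in\mathbb{R}^N$ with $\sum_i\lambda_i a_i=o$ and $\sum_i\lambda_i=0$, has dimension $N-d-1$. Choose a basis of it and write the basis vectors as the rows of an $(N-d-1)\times N$ matrix. The sequence $(\overline a_1,\dots,\overline a_N)$ of columns of this matrix (vectors in $\mathbb{R}^{N-d-1}$) is a Gale transform of $(a_1,\dots,a_N)$. Conversely, any sequence $(\overline a_1,\dots,\overline a_N)$ linearly spanning $\mathbb{R}^{N-d-1}$ with $\overline a_1+\dots+\overline a_N=o$ is a Gale transform of some (non-unique) sequence of points in $\mathbb{R}^d$. **Random Gale diagram.** A $(\phi,N)$ random Gale diagram is a sequence $(X_1,\dots,X_N)$ of independent random vectors in $\mathbb{R}^{N-d-1}$ with distribution $\phi$, under the condition that $o\in\operatorname{conv}\{X_1,\dots,X_N\}$. That is, its law is that of an i.i.d. sequence $(Y_1,\dots,Y_N)$ with distribution $\phi$, conditioned on the event $o\in\operatorname{conv}\{Y_1,\dots,Y_N\}$. **The polytope $G_{d,N}$.** Almost surely $X_1,\dots,X_N$ are in linearly general position (any at most $N-d-1$ of them are linearly independent) and $o\in\operatorname{int}\operatorname{conv}\{X_1,\dots,X_N\}$. Hence there are $\lambda_1,\dots,\lambda_N>0$ such that $(\overline a_1,\dots,\overline a_N)=(\lambda_1X_1,\dots,\lambda_NX_N)$ satisfies $\overline a_1+\dots+\overline a_N=o$.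 Then $(\overline a_1,\dots,\overline a_N)$ is a Gale transform of a sequence $(a_1,\dots,a_N)$ in $\mathbb{R}^d$, and $G_{d,N}:=\operatorname{conv}\{a_1,\dots,a_N\}$. The polytope $G_{d,N}$ is not uniquely determined by $(X_1,\dots,X_N)$, but all possible choices are combinatorially isomorphic, so the number $f_k(G_{d,N})$ of $k$-dimensional faces is a well-defined random variable depending only on $(X_1,\dots,X_N)$. **Threshold $\rho_S$.** With $\log$ the natural logarithm and $0\log 0:=0$, put $$H(x):=-x\log x-(1-x)\log(1-x),\quad 0\le x\le 1,$$ $$G(\delta,\rho):=H(\delta)+\delta H(\rho)-(1-\delta\rho)\log 2,\quad 0\le\delta,\rho\le1.$$ For $1/2<\delta<1$, the function $G(\delta,\cdot)$ has a unique zero in $(0,1)$, denoted by $\rho_S(\delta)$. *)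

(* Defs.v *)
From HB Require Import structures.
From mathcomp Require Import all_boot all_order all_algebra.
From mathcomp Require Import all_classical all_reals all_analysis.

Set Implicit Arguments.
Unset Strict Implicit.
Unset Printing Implicit Defensive.

Import Order.TTheory GRing.Theory Num.Theory.
Import numFieldNormedType.Exports.
Local Open Scope classical_set_scope.
Local Open Scope ring_scope.

(* [ln 0 = 0] in the library, so the convention [0 log 0 = 0] holds. *)
Definition entropy (R : realType) (x : R) : R :=
  - x * ln x - (1 - x) * ln (1 - x).

Definition Gfun (R : realType) (delta rho : R) : R :=
  entropy delta + delta * entropy rho - (1 - delta * rho) * ln 2.

(* For 1/2 < delta < 1 the zero in ]0, 1[ exists and is unique; the default
   value 0 is only relevant for the other values of delta. *)
Definition rho_S (R : realType) (delta : R) : R :=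
  xget 0 [set rho | 0 < rho < 1 /\ Gfun delta rho = 0].

Definition convex_hull (R : realType) (V : lmodType R) (A : set V) : set V :=
  [set y | exists n (w : 'I_n -> R) (p : 'I_n -> V),
     [/\ forall i, A (p i), forall i, 0 <= w i, \sum_i w i = 1
       & y = \sum_i w i *: p i]].

Definition affine_hull (R : realType) (V : lmodType R) (A : set V) : set V :=
  [set y | exists n (w : 'I_n -> R) (p : 'I_n -> V),
     [/\ forall i, A (p i), \sum_i w i = 1 & y = \sum_i w i *: p i]].

Definition has_affine_dim (R : realType) (d : nat) (F : set 'rV[R]_d)
    (k : nat) : Prop :=
  exists (p : 'rV[R]_d) (U : {vspace 'rV[R]_d}),
    \dim U = k /\ affine_hull F = [set p + u | u in [set u | u \in U]].

(* A face is the set where a valid linear inequality [x *m c <= b] is tight;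
   [c = 0] gives the improper faces. *)
Definition is_face (R : realType) (d : nat) (Q F : set 'rV[R]_d) : Prop :=
  exists (c : 'cV[R]_d) (b : R),
    (forall x, Q x -> (x *m c) 0 0 <= b) /\
    F = Q `&` [set x | (x *m c) 0 0 = b].

Definition faces (R : realType) (d : nat) (k : nat) (Q : set 'rV[R]_d) :
    set (set 'rV[R]_d) :=
  [set F | is_face Q F /\ has_affine_dim F k].

Definition affine_dependence (R : realType) (d N : nat)
    (a : 'I_N -> 'rV[R]_d) (l : 'rV[R]_N) : Prop :=
  \sum_i l 0 i *: a i = 0 /\ \sum_i l 0 i = 0.

(* The rows of the matrix with columns [abar i] form a basis of the space of
   affine dependences of [a]. *)
Definition gale_transform (R : realType) (d N : nat)
    (a : 'I_N -> 'rV[R]_d) (abar : 'I_N -> 'rV[R]_(N - d - 1)) : Prop :=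
  let B : 'M[R]_(N - d - 1, N) := \matrix_(j, i) abar i 0 j in
  [/\ affine_hull (range a) = setT,
      row_free B
    & forall l : 'rV[R]_N, (l <= B)%MS <-> affine_dependence a l].

(* [m.-tuple R] serves as R^m: its measurable sets are those of the product
   sigma-algebra, i.e. the Borel sets. *)
Definition vec (R : realType) (m : nat) (x : m.-tuple R) : 'rV[R]_m :=
  \row_j tnth x j.

(* The class of polytopes obtained from [x] by all choices of the positive
   factors [lam] and of the sequence [a]. *)
Definition gale_polytopes (R : realType) (d N : nat)
    (x : N.-tuple ((N - d - 1).-tuple R)) : set (set 'rV[R]_d) :=
  [set Q | exists (lam : 'I_N -> R) (a : 'I_N -> 'rV[R]_d),
     [/\ forall i, 0 < lam i,
         \sum_i lam i *: vec (tnth x i) = 0,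
         gale_transform a (fun i => lam i *: vec (tnth x i))
       & Q = convex_hull (range a)]].

(* The members of a class of combinatorially isomorphic polytopes have [n]
   faces of dimension [k]; the class must be inhabited. *)
Definition face_number_is (R : realType) (d : nat) (k : nat)
    (C : set (set 'rV[R]_d)) (n : nat) : Prop :=
  C !=set0 /\ forall Q, C Q -> (faces k Q #= `I_n)%card.

Definition even_measure (R : realType) (m : nat)
    (phi : probability (m.-tuple R) R) : Prop :=
  forall A : set (m.-tuple R), measurable A ->
    phi [set x | A (map_tuple -%R x)] = phi A.

Definition null_on_hyperplanes (R : realType) (m : nat)
    (phi : probability (m.-tuple R) R) : Prop :=
  forall u : 'rV[R]_m, u != 0 ->
    phi [set x | \sum_j u 0 j * tnth x j = 0] = 0%E.

Definition iid (R : realType) (d d' : measure_display) (T : measurableType d)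
    (E : measurableType d') (N : nat) (Q : probability T R)
    (phi : probability E R) (Y : {RV Q >-> N.-tuple E}) : Prop :=
  (forall i (A : set E), measurable A ->
     Q [set w | A (tnth (Y w) i)] = phi A) /\
  (forall (J : {set 'I_N}) (A : 'I_N -> set E),
     (forall i, measurable (A i)) ->
     Q [set w | forall i, i \in J -> A i (tnth (Y w) i)] =
     (\prod_(i in J) Q [set w | A i (tnth (Y w) i)])%E).

Definition origin_in_conv (R : realType) (m N : nat) :
    set (N.-tuple (m.-tuple R)) :=
  [set x | convex_hull (range (fun i => vec (tnth x i))) 0].

Definition cond_prob (R : realType) (d : measure_display)
    (T : measurableType d) (Q : probability T R) (A B : set T) : R :=
  fine (Q (A `&` B)) / fine (Q B).

(* The law of [X] is that of an i.i.d. sequence [Y] with distribution [phi],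
   conditioned on the origin being in the convex hull of [Y]. *)
Definition random_gale_diagram (R : realType) (d : measure_display)
    (T : measurableType d) (P : probability T R) (m N : nat)
    (phi : probability (m.-tuple R) R)
    (X : {RV P >-> N.-tuple (m.-tuple R)}) : Prop :=
  exists (d' : measure_display) (T' : measurableType d')
    (Q : probability T' R) (Y : {RV Q >-> N.-tuple (m.-tuple R)}),
    iid phi Y /\
    forall A : set (N.-tuple (m.-tuple R)), measurable A ->
      P (X @^-1` A) = (cond_prob Q (Y @^-1` A) (Y @^-1` @origin_in_conv R m N))%:E.

(* Main.v *)
Require Import Defs.
From HB Require Import structures.
From mathcomp Require Import all_boot all_order all_algebra.
From mathcomp Require Import all_classical all_reals all_analysis.
From mathcomp Require Import measurable_realfun ring lra zify.

Import Order.TTheory GRing.Theory Num.Theory.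
Import numFieldNormedType.Exports.
Local Open Scope classical_set_scope.
Local Open Scope ring_scope.

(* By Gale duality, the polytope has all 'C(N, k+1) possible k-faces iff for each
   (k+1)-subset J of the indices the origin is an interior point of the convex
   hull of the X_i with i outside J. For an even distribution, flipping the signs
   of n vectors of R^m turns the probability that the origin is not interior into
   the proportion of sign patterns realized by an arrangement of n hyperplanes
   through the origin, which is at most 2^(1-n) * sum_(i < m) 'C(n-1, i) (Cover,
   Wendel). Points in degenerate position are negligible because hyperplanes are,
   and for N <= 2d + 2 the conditioning event has probability at least 1/2. A
   union bound over J, with n = N-k-1 and m = N-d-1, gives a failure probability
   of order exp(N G(delta, rho)), and G(delta, rho) < 0 below the threshold since
   G(delta, .) is concave and positive at 1. *)

Set Implicit Arguments.
Unset Strict Implicit.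
Unset Printing Implicit Defensive.

(** * Farkas' lemma and positive spanning *)

(** The law of the diagram is prescribed on measurable sets only, whereas the geometric conditions
    quantify over all real vectors [u]. Farkas' lemma turns such a condition into the existence of
    finitely many coefficients, and these can be replaced by rational ones, so that the events
    become countable combinations of elementary ones. Independence enters only through the values of
    a measure on boxes; sign flips and the resampling of one point preserve these values, hence the
    law. The asymptotics avoid Stirling's formula: two binomial expansions with weights
    [delta * rho], [delta * (1 - rho)] and [1 - delta], the limits of the proportions of k+1, d-k
    and N-d-1 in N, bound the counts, and the logarithm of the resulting bound is N times the
    exponent by mere regrouping. The price is the condition [1 - delta <= delta * (1 - rho)], under
    which a truncated binomial sum is controlled by its last weight; it has to be derived from
    [rho < rho_S delta]. *)

Definition dotv (R : realType) (m : nat) (u v : 'rV[R]_m) : R :=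
  \sum_j u 0 j * v 0 j.

Section dot.
Context {R : realType} {m : nat}.
Implicit Types u v w : 'rV[R]_m.

Lemma dotvE u v : dotv u v = (u *m v^T) 0 0.
Proof. by rewrite mxE; apply: eq_bigr => j _; rewrite mxE. Qed.

Lemma dotvC u v : dotv u v = dotv v u.
Proof. by apply: eq_bigr => j _; rewrite mulrC. Qed.

Lemma dotvDr u v w : dotv u (v + w) = dotv u v + dotv u w.
Proof. by rewrite !dotvE linearD mulmxDr mxE. Qed.

Lemma dotvZr c u v : dotv u (c *: v) = c * dotv u v.
Proof. by rewrite !dotvE linearZ /= -scalemxAr mxE. Qed.

Lemma dotvNr u v : dotv u (- v) = - dotv u v.
Proof. by rewrite -scaleN1r dotvZr mulN1r. Qed.

Lemma dotv0r u : dotv u 0 = 0.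
Proof. by rewrite -(scale0r 0) dotvZr mul0r. Qed.

Lemma dotv_sumr u (I : Type) (r : seq I) (P : pred I) (F : I -> 'rV[R]_m) :
  dotv u (\sum_(i <- r | P i) F i) = \sum_(i <- r | P i) dotv u (F i).
Proof. by apply: big_morph; [exact: dotvDr | exact: dotv0r]. Qed.

Lemma dotvDl u v w : dotv (u + v) w = dotv u w + dotv v w.
Proof. by rewrite !(dotvC _ w) dotvDr. Qed.

Lemma dotvZl c u v : dotv (c *: u) v = c * dotv u v.
Proof. by rewrite !(dotvC _ v) dotvZr. Qed.

Lemma dotvNl u v : dotv (- u) v = - dotv u v.
Proof. by rewrite !(dotvC _ v) dotvNr. Qed.

Lemma dotv0l u : dotv 0 u = 0.
Proof. by rewrite dotvC dotv0r. Qed.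

Lemma dotv_ge0 u : 0 <= dotv u u.
Proof. by apply: sumr_ge0 => j _; rewrite -expr2 sqr_ge0. Qed.

Lemma dotv_eq0 u : (dotv u u == 0) = (u == 0).
Proof.
apply/eqP/eqP => [u0|->]; last exact: dotv0l.
apply/rowP => j; rewrite mxE; apply/eqP; rewrite -sqrf_eq0 expr2; apply/eqP.
by apply: (psumr_eq0P _ u0) => // i _; rewrite -expr2 sqr_ge0.
Qed.

Lemma dotv_delta u j : dotv u (delta_mx 0 j) = u 0 j.
Proof.
rewrite /dotv (bigD1 j) //= mxE !eqxx mulr1 big1 ?addr0 // => i ij.
by rewrite mxE (negbTE ij) andbF mulr0.
Qed.

End dot.

Lemma dotv_row_mx (R : realType) m n (u1 v1 : 'rV[R]_m) (u2 v2 : 'rV[R]_n) :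
  dotv (row_mx u1 u2) (row_mx v1 v2) = dotv u1 v1 + dotv u2 v2.
Proof. by rewrite !dotvE tr_row_mx mul_row_col mxE. Qed.

(* Bartl's induction: if the functional [a i0] cannot be dropped, a witness [z]
   of this fact allows to eliminate it by projecting along [z]. *)
Lemma farkas (R : realType) (m : nat) (I : finType) (A : {set I})
    (a : I -> 'rV[R]_m) (g : 'rV[R]_m) :
  (forall u, (forall i, i \in A -> dotv u (a i) <= 0) -> dotv u g <= 0) ->
  exists2 c : I -> R, forall i, 0 <= c i & g = \sum_(i in A) c i *: a i.
Proof.
have [n An] := ubnP #|A|; elim: n => // n IH in A An a g *.
have [->|[i0 i0A]] := set_0Vmem A => H.
  exists (fun=> 0) => //; rewrite big_set0; apply/eqP; rewrite -dotv_eq0.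
  by rewrite eq_le dotv_ge0 H // => i; rewrite inE.
have An' : (#|A :\ i0| < n)%N by rewrite (cardsD1 i0) i0A in An.
have [[u /not_implyP[Hu /negP]]|H'] := pselect (exists u,
    ~ ((forall i, i \in A :\ i0 -> dotv u (a i) <= 0) -> dotv u g <= 0)).
  rewrite -ltNge => ug.
  have ua : 0 < dotv u (a i0).
    rewrite ltNge; apply/negP => ui0; move: ug; rewrite ltNge => /negP; apply.
    apply: H => i iA; have [->//|ii0] := eqVneq i i0.
    by apply: Hu; rewrite !inE ii0.
  pose t := (dotv u (a i0))^-1; have t0 : 0 < t by rewrite invr_gt0.
  have tE : t * dotv u (a i0) = 1 by rewrite mulVf // gt_eqF.
  have [z zE] : exists z : 'rV_m, forall v, dotv z v = t * dotv u v.
    by exists (t *: u) => v; rewrite dotvZl.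
  (* [p] is the projection onto the kernel of [z] along [a i0]. Its adjoint in [pE] sends [w] to a
     functional vanishing on [a i0], so the hypothesis [H] applies to that functional. *)
  pose p (v : 'rV_m) : 'rV_m := v - dotv z v *: a i0.
  have pE w v : dotv w (p v) = dotv (w - dotv w (a i0) *: z) v.
    by rewrite /p dotvDr dotvNr dotvZr dotvDl dotvNl dotvZl mulrC.
  have [|c c0 cE] := IH (A :\ i0) An' (fun i => p (a i)) (p g).
    move=> w Hw; rewrite pE; apply: H => i iA; rewrite -pE.
    have [->|ii0] := eqVneq i i0; last by apply: Hw; rewrite !inE ii0.
    by rewrite /p zE tE scale1r subrr dotv0r.
  (* Undoing the projection forces this coefficient at [i0]. It is non-negative because [z] is
     positive at [g] and non-positive at the other generators. *)
  pose c' i := if i == i0 then dotv z g - \sum_(j in A :\ i0) c j * dotv z (a j)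
     else c i.
  exists c'.
    move=> i; rewrite /c'; case: ifP => // _; rewrite subr_ge0.
    apply: (@le_trans _ _ 0).
      apply: sumr_le0 => j jA; rewrite mulr_ge0_le0 // zE pmulr_rle0 //; exact: Hu.
    by rewrite zE mulr_ge0 ?ltW.
  rewrite (big_setD1 i0) //= /c' eqxx scalerBl.
  rewrite (eq_bigr (fun j => c j *: p (a j) + (c j * dotv z (a j)) *: a i0)).
    rewrite big_split /= -cE -scaler_suml /p addrACA addNr addr0.
    by rewrite addrC subrK.
  move=> j /setD1P[/negbTE-> _]; rewrite /p scalerBr scalerA subrK //.
have [|c c0 cE] := IH (A :\ i0) An' a g.
  by move=> u; apply: contrapT => Hu; apply: H'; exists u.
exists (fun i => if i == i0 then 0 else c i).
  by move=> i; case: ifP.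
rewrite (big_setD1 i0) //= eqxx scale0r add0r cE; apply: eq_bigr => j.
by case/setD1P => /negbTE->.
Qed.

(* Dual form of: the cone generated by [x i], [i \in A], is the whole space. *)
Definition positively_spans (R : realType) (m : nat) (I : finType)
    (A : {set I}) (x : I -> 'rV[R]_m) : Prop :=
  forall u, u != 0 -> exists2 i, i \in A & 0 < dotv u (x i).

Definition open_halfspace (R : realType) (m : nat) (I : finType)
    (A : {set I}) (x : I -> 'rV[R]_m) : Prop :=
  exists u, forall i, i \in A -> 0 < dotv u (x i).

Section positive_span.
Context {R : realType} {m : nat} {I : finType}.
Implicit Types (A : {set I}) (x : I -> 'rV[R]_m).

Lemma positively_spansP A x v : positively_spans A x ->
  exists2 c : I -> R, forall i, 0 <= c i & v = \sum_(i in A) c i *: x i.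
Proof.
move=> xA; apply: farkas => u Hu.
have [->|/xA[i iA]] := eqVneq u 0; first by rewrite dotv0l.
by rewrite ltNge Hu.
Qed.

(** Minus the sum of the vectors is a non-negative combination of them; adding 1 to each coefficient
    makes all of them strictly positive. *)
Lemma positively_spans_dependence A x : positively_spans A x ->
  exists2 c : I -> R, forall i, i \in A -> 0 < c i & \sum_(i in A) c i *: x i = 0.
Proof.
move=> /(positively_spansP (- \sum_(i in A) x i))[c c0 cE].
exists (fun i => c i + 1) => [i _|]; first by rewrite ltr_wpDl.
under eq_bigr do rewrite scalerDl scale1r.
by rewrite big_split /= -cE addrC subrr.
Qed.

(** Gordan's alternative is Farkas' lemma for the vectors [(x i, 1)] and the target [(0, 1)]; the
    extra coordinate carries the normalization of the weights. *)
Lemma gordan A x : ~ open_halfspace A x <->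
  exists c : I -> R,
    [/\ forall i, 0 <= c i, \sum_(i in A) c i = 1 & \sum_(i in A) c i *: x i = 0].
Proof.
split=> [nu|[c [c0 c1 cx]] [u Hu]]; last first.
  have H i : i \in A -> c i * dotv u (x i) = 0.
    move: i; apply: psumr_eq0P => [i /Hu/ltW ?|]; first exact: mulr_ge0.
    have := congr1 (dotv u) cx; rewrite dotv_sumr dotv0r => E.
    by rewrite -[RHS]E; apply: eq_bigr => i _; rewrite dotvZr.
  suff : \sum_(i in A) c i = 0 by rewrite c1 => /eqP; rewrite oner_eq0.
  rewrite big1 // => i iA; have /eqP := H i iA.
  by rewrite mulf_eq0 (gt_eqF (Hu i iA)) orbF => /eqP.
have [|c c0 cE] := @farkas R _ I A (fun i => row_mx (x i) (1 : 'rV_1))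
    (row_mx 0 (1 : 'rV_1)).
  move=> w; rewrite -(hsubmxK w) dotv_row_mx dotv0r add0r => Hw.
  rewrite leNgt; apply/negP => w0; apply: nu; exists (- lsubmx w) => i /Hw.
  by rewrite dotv_row_mx dotvNl => H; rewrite oppr_gt0; lra.
have {cE} cE : row_mx 0 1 = row_mx (\sum_(i in A) c i *: x i)
   (\sum_(i in A) c i *: (1 : 'rV[R]_1)).
  rewrite cE; elim/big_rec3: _ => [|i y1 y2 y3 _ ->]; first by rewrite row_mx0.
  by rewrite scale_row_mx add_row_mx.
have [cx c1] := eq_row_mx cE.
exists c; split => //; move/matrixP/(_ 0 0): c1; rewrite summxE [LHS]mxE => E.
transitivity (\sum_(i in A) (c i *: (1 : 'rV[R]_1)) 0 0); last exact: esym E.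
by apply: eq_bigr => i _; rewrite !mxE mulr1.
Qed.

End positive_span.

(** Collecting the weights of repeated points gives one weight per index, a form that sums over [I]
    can use directly. *)
Lemma convex_hull_range (R : realType) (V : lmodType R) (I : finType)
    (p : I -> V) (y : V) :
  convex_hull (range p) y <->
  exists w : I -> R, [/\ forall i, 0 <= w i, \sum_i w i = 1 & y = \sum_i w i *: p i].
Proof.
split=> [[n [w [q [qp w0 w1 ->]]]]|[w [w0 w1 ->]]].
  pose f j := sval (cid2 (qp j)); have fE j : p (f j) = q j.
    by rewrite /f; case: cid2.
  exists (fun i => \sum_(j | f j == i) w j); split.
  - by move=> i; apply: sumr_ge0.
  - by rewrite -w1 (partition_big f xpredT).
  - rewrite (partition_big f xpredT) //=; apply: eq_bigr => i _.
    by rewrite scaler_suml; apply: eq_bigr => j /eqP <-; rewrite fE.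
exists #|I|, (w \o enum_val), (p \o enum_val); split => //=.
- by move=> i; exists (enum_val i).
- by rewrite -w1 (reindex (@enum_val I xpredT)) //=; apply: onW_bij; exact: enum_val_bij.
- by rewrite (reindex (@enum_val I xpredT)) //=; apply: onW_bij; exact: enum_val_bij.
Qed.

Lemma origin_in_conv_gordan (R : realType) (m N : nat)
    (x : N.-tuple (m.-tuple R)) :
  origin_in_conv x <-> ~ open_halfspace [set: 'I_N] (fun i => vec (tnth x i)).
Proof.
rewrite /origin_in_conv /= convex_hull_range gordan.
have E (V : nmodType) (F : 'I_N -> V) : \sum_(i in [set: 'I_N]%SET) F i = \sum_i F i.
  by apply: eq_bigl => i; rewrite inE.
split=> [[w [w0 w1 w2]]|[c [c0 c1 c2]]].
  by exists w; rewrite !E.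
by exists c; rewrite !E in c1 c2.
Qed.

(** * Faces and affine hulls in homogeneous coordinates *)

Lemma vspace_mx (R : realType) d (U : {vspace 'rV[R]_d}) :
  exists2 M : 'M[R]_(\dim U, d), row_free M & forall u, (u \in U) = (u <= M)%MS.
Proof.
exists (\matrix_i (vbasis U)`_i).
  apply: inj_row_free => v; rewrite mulmx_sum_row => v0.
  have /basis_free/freeP/(_ (fun i => v 0 i)) H := vbasisP U.
  apply/rowP => i; rewrite mxE; apply: H; rewrite -[RHS]v0.
  by apply: eq_bigr => j _; rewrite rowK.
move=> u; apply/idP/idP => [/coord_vbasis ->|/submxP[D ->]].
  by apply: summx_sub => i _; apply: scalemx_sub; rewrite -(rowK (fun j => (vbasis U)`_j)) row_sub.
rewrite mulmx_sum_row; apply: memv_suml => i _; rewrite rowK memvZ //.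
by apply: vbasis_mem; rewrite mem_nth ?size_tuple.
Qed.

Lemma mx_vspace (R : realType) d r (M : 'M[R]_(r, d)) : row_free M ->
  exists U : {vspace 'rV[R]_d}, \dim U = r /\ forall u, (u \in U) = (u <= M)%MS.
Proof.
move=> Mf; pose X := [tuple row i M | i < r]; exists <<X>>%VS; split.
  suff : free X by rewrite /free size_tuple => /eqP.
  apply/freeP => c cX i.
  have : (\row_i c i) *m M = 0.
    rewrite mulmx_sum_row -[RHS]cX; apply: eq_bigr => j _.
    by rewrite mxE -tnth_nth tnth_mktuple.
  by move/eqP; rewrite mulmx_free_eq0 // => /eqP/rowP/(_ i); rewrite !mxE.
move=> u; apply/idP/idP => [/coord_span ->|/submxP[D ->]].
  apply: summx_sub => i _; apply: scalemx_sub.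
  by rewrite -tnth_nth tnth_mktuple row_sub.
rewrite mulmx_sum_row; apply: memv_suml => i _; apply: memvZ; apply: memv_span.
by apply/mapP; exists i; rewrite ?mem_enum.
Qed.

(** Affine hulls become row spaces and affine dimension becomes rank minus one, so faces can be
    handled by matrix rank. *)
Definition homog (R : realType) d (y : 'rV[R]_d) : 'rV[R]_(1 + d) := row_mx 1 y.

Definition homog_mx (R : realType) d N (a : 'I_N -> 'rV[R]_d) (J : {set 'I_N}) :
    'M[R]_(#|J|, 1 + d) :=
  \matrix_i homog (a (enum_val i)).

Section homogenization.
Context {R : realType} {d N : nat}.
Implicit Types (a : 'I_N -> 'rV[R]_d) (J : {set 'I_N}) (y p : 'rV[R]_d).

Lemma homog_comb (I : Type) (r : seq I) (P : pred I) (w : I -> R) (q : I -> 'rV[R]_d) :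
  \sum_(i <- r | P i) w i *: homog (q i) =
  row_mx (\sum_(i <- r | P i) w i)%:M (\sum_(i <- r | P i) w i *: q i).
Proof.
elim/big_rec3: _ => [|i y1 y2 y3 _ ->]; first by rewrite raddf0 row_mx0.
by rewrite scale_row_mx add_row_mx raddfD /= scalemx1.
Qed.

Lemma homog_affine (I : Type) (r : seq I) (P : pred I) (w : I -> R) (q : I -> 'rV[R]_d) :
  \sum_(i <- r | P i) w i = 1 ->
  homog (\sum_(i <- r | P i) w i *: q i) = \sum_(i <- r | P i) w i *: homog (q i).
Proof. by move=> w1; rewrite homog_comb w1. Qed.

Lemma homog_mx_mem a J i : i \in J -> (homog (a i) <= homog_mx a J)%MS.
Proof.
move=> iJ; apply: (eq_row_sub (enum_rank_in iJ i)).
by rewrite rowK enum_rankK_in.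
Qed.

Lemma homog_mx_subP n a J (M : 'M[R]_(n, 1 + d)) :
  (forall i, i \in J -> (homog (a i) <= M)%MS) -> (homog_mx a J <= M)%MS.
Proof. by move=> H; apply/row_subP => i; rewrite rowK H ?enum_valP. Qed.

Lemma homog_subP a J y : (homog y <= homog_mx a J)%MS ->
  exists2 l : 'I_N -> R, \sum_(i in J) l i = 1 & y = \sum_(i in J) l i *: a i.
Proof.
case/submxP => D; rewrite mulmx_sum_row.
under eq_bigr do rewrite rowK.
rewrite homog_comb => /eq_row_mx[D1 ->].
have {}D1 : \sum_i D 0 i = 1.
  by move/matrixP/(_ 0 0): D1; rewrite !mxE eqxx => E; exact: esym E.
(* For empty [J] the weights would sum to 0 instead of 1; otherwise a member of [J] serves as the
   default for [enum_rank_in]. *)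
have [i0|J0] := pickP [in J]; last first.
  suff E : \sum_i D 0 i = 0 by move: D1; rewrite E => /eqP; rewrite eq_sym oner_eq0.
  by apply: big1 => i _; have := J0 (enum_val i); rewrite /= enum_valP.
move=> i0J; exists (fun i => D 0 (enum_rank_in i0J i)).
  rewrite big_enum_val -[RHS]D1; apply: eq_bigr => i _.
  by rewrite enum_valK_in.
rewrite [RHS]big_enum_val; apply: eq_bigr => i _.
by rewrite enum_valK_in.
Qed.

Lemma homog_sub_eq a J y (c : 'cV[R]_d) b :
  (forall i, i \in J -> (a i *m c) 0 0 = b) -> (homog y <= homog_mx a J)%MS ->
  (y *m c) 0 0 = b.
Proof.
move=> ac /homog_subP[l l1 ->]; rewrite mulmx_suml summxE -[RHS]mul1r -l1 mulr_suml.
by apply: eq_bigr => i iJ; rewrite -scalemxAl mxE ac.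
Qed.

Lemma affine_hull_homog a J (F : set 'rV[R]_d) :
  (forall y, F y -> homog y <= homog_mx a J)%MS -> (forall i, i \in J -> F (a i)) ->
  affine_hull F = [set y | homog y <= homog_mx a J]%MS.
Proof.
move=> FJ aF; apply/seteqP; split => [_ [n [w [q [qF w1 ->]]]]|y /homog_subP[l l1 ->]] /=.
  rewrite homog_affine //; apply: summx_sub => i _; exact/scalemx_sub/FJ.
exists #|J|, (l \o enum_val), (a \o enum_val); split => /=.
- by move=> i; apply: aF; exact: enum_valP.
- by rewrite -l1 [RHS]big_enum_val.
- by rewrite big_enum_val.
Qed.

(* The block matrix spans the homogenization of the affine space [p] + row space
   of [M]. *)
Lemma homog_block_free k p (M : 'M[R]_(k, d)) : row_free M ->
  row_free (col_mx (homog p) (row_mx 0 M)).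
Proof.
move=> Mf; apply: inj_row_free => v; rewrite -(hsubmxK v) mul_row_col.
rewrite !mul_mx_row mulmx1 mulmx0 add_row_mx addr0 -[in RHS]row_mx0.
case/eq_row_mx => -> /eqP; rewrite mul0mx add0r mulmx_free_eq0 // => /eqP ->.
by rewrite row_mx0.
Qed.

Lemma homog_blockP k p y (M : 'M[R]_(k, d)) :
  (homog y <= col_mx (homog p) (row_mx 0 M))%MS = (y - p <= M)%MS.
Proof.
apply/submxP/submxP => [[D]|[D E]].
  rewrite -(hsubmxK D) mul_row_col !mul_mx_row mulmx1 mulmx0 add_row_mx addr0.
  case/eq_row_mx => <- ->; exists (rsubmx D).
  by rewrite mul1mx addrC addKr.
exists (row_mx 1 D); rewrite mul_row_col mul1mx mul_mx_row mulmx0 add_row_mx addr0.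
by rewrite -E addrC subrK.
Qed.

Lemma homog_block_eqmx k a J p (M : 'M[R]_(k, d)) :
  (homog p <= homog_mx a J)%MS -> (forall i, i \in J -> (a i - p <= M)%MS) ->
  (row_mx 0 M <= homog_mx a J)%MS ->
  (col_mx (homog p) (row_mx 0 M) :=: homog_mx a J)%MS.
Proof.
move=> pJ aM MJ; apply/eqmxP/andP; split; first by rewrite col_mx_sub pJ.
by apply: homog_mx_subP => i iJ; rewrite homog_blockP aM.
Qed.

Lemma homogB y p : homog y - homog p = row_mx 0 (y - p).
Proof. by rewrite /homog opp_row_mx add_row_mx subrr. Qed.

Lemma has_affine_dim_homog k a J (F : set 'rV[R]_d) :
  affine_hull F = [set y | homog y <= homog_mx a J]%MS ->
  has_affine_dim F k <-> \rank (homog_mx a J) = k.+1.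
Proof.
rewrite /has_affine_dim => ->; split=> [[p [U [<- UJ]]]|rJ].
  have [M Mf UM] := vspace_mx U.
  have JE y : (homog y <= homog_mx a J)%MS = (y - p <= M)%MS.
    rewrite -UM; apply/idP/idP.
      move=> yJ; have : [set y | homog y <= homog_mx a J]%MS y by [].
      by rewrite UJ => -[u uU <-]; rewrite addrC addKr.
    move=> yU; suff : [set y | homog y <= homog_mx a J]%MS y by [].
    by rewrite UJ; exists (y - p) => //; rewrite addrC subrK.
  have pJ : (homog p <= homog_mx a J)%MS by rewrite JE subrr sub0mx.
  have <- : (col_mx (homog p) (row_mx 0 M) :=: homog_mx a J)%MS.
    apply: homog_block_eqmx => // [i iJ|]; first by rewrite -JE homog_mx_mem.
    apply/row_subP => i; rewrite row_row_mx row0.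
    rewrite -[row i M](addrK p) -homogB addmx_sub ?eqmx_opp //.
    by rewrite JE addrK row_sub.
  by have /eqP-> := homog_block_free p Mf.
have [i0 i0J] : exists i0, i0 \in J.
  by apply/card_gt0P; apply: leq_trans (rank_leq_row (homog_mx a J)); rewrite rJ.
pose p := a i0; pose D := \matrix_(i < #|J|) (a (enum_val i) - p).
have DJ : (row_mx 0 D <= homog_mx a J)%MS.
  apply/row_subP => i; rewrite row_row_mx row0 rowK -homogB.
  by rewrite addmx_sub ?eqmx_opp // homog_mx_mem // enum_valP.
have E : (col_mx (homog p) (row_mx 0 (row_base D)) :=: homog_mx a J)%MS.
  apply: homog_block_eqmx; first exact: homog_mx_mem.
    move=> i iJ; rewrite eq_row_base; apply: (eq_row_sub (enum_rank_in iJ i)).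
    by rewrite rowK enum_rankK_in.
  have /submxP[X ->] : (row_base D <= D)%MS by rewrite eq_row_base.
  by rewrite -(mulmx0 _ X) -mul_mx_row (submx_trans (submxMl _ _)).
have [U [dU UD]] := mx_vspace (row_base_free D).
exists p, U; split.
  have /eqP := homog_block_free p (row_base_free D).
  by rewrite E rJ add1n => -[->].
apply/seteqP; split => [y /=|_ [u /= uU <-]] /=.
  rewrite -E homog_blockP -UD => yU; exists (y - p) => //.
  by rewrite addrC subrK.
by rewrite -E homog_blockP -UD addrC addKr.
Qed.

End homogenization.

(** This set makes sense for every [J], whether or not it is a face. A face can thus be named by any
    index set whose points affinely span it. *)
Definition face_hull (R : realType) d N (a : 'I_N -> 'rV[R]_d) (J : {set 'I_N}) :
    set 'rV[R]_d :=
  convex_hull (range a) `&` [set y | homog y <= homog_mx a J]%MS.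

Section face_hull.
Context {R : realType} {d N : nat}.
Implicit Types (a : 'I_N -> 'rV[R]_d) (J : {set 'I_N}) (y p : 'rV[R]_d).

Lemma point_in_hull a i : convex_hull (range a) (a i).
Proof.
apply/convex_hull_range; exists (fun j => (j == i)%:R); split => //.
  by rewrite (bigD1 i) //= eqxx big1 ?addr0 // => j /negbTE ->.
rewrite (bigD1 i) //= eqxx scale1r big1 ?addr0 // => j /negbTE ->.
by rewrite scale0r.
Qed.

Lemma face_hull_point a J i : i \in J -> face_hull a J (a i).
Proof. by move=> iJ; split; [exact: point_in_hull|exact: homog_mx_mem]. Qed.

Lemma affine_hull_face a J :
  affine_hull (face_hull a J) = [set y | homog y <= homog_mx a J]%MS.
Proof. by apply: affine_hull_homog => [y []//|i]; exact: face_hull_point. Qed.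

(** The slack of the inequality at a convex combination is the weighted mean of the slacks at the
    points, so it vanishes only if all the weight lies on [J]. *)
Lemma face_hullE a J (c : 'cV[R]_d) b :
  (forall i, (a i *m c) 0 0 <= b) -> (forall i, (i \in J) = ((a i *m c) 0 0 == b)) ->
  (forall x, convex_hull (range a) x -> (x *m c) 0 0 <= b) /\
  convex_hull (range a) `&` [set x | (x *m c) 0 0 = b] = face_hull a J.
Proof.
move=> le_b JE.
have cE (w : 'I_N -> R) : \sum_i w i = 1 ->
    b - ((\sum_i w i *: a i) *m c) 0 0 = \sum_i w i * (b - (a i *m c) 0 0).
  move=> w1; under [RHS]eq_bigr do rewrite mulrBr.
  rewrite sumrB -mulr_suml w1 mul1r mulmx_suml summxE; congr (_ - _).
  by apply: eq_bigr => i _; rewrite -scalemxAl mxE.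
split=> [x /convex_hull_range[w [w0 w1 ->]]|].
  rewrite -subr_ge0 cE //; apply: sumr_ge0 => i _.
  by rewrite mulr_ge0 // subr_ge0.
apply/seteqP; split => y [Qy /= yb]; split => //=; last first.
  by apply: (homog_sub_eq _ yb) => i; rewrite JE => /eqP.
have /convex_hull_range[w [w0 w1 yE]] := Qy; rewrite yE.
have H : \sum_i w i * (b - (a i *m c) 0 0) = 0 by rewrite -cE // -yE yb subrr.
rewrite homog_affine //; apply: summx_sub => i _.
have [iJ|iJ] := boolP (i \in J); first exact/scalemx_sub/homog_mx_mem.
suff -> : w i = 0 by rewrite scale0r sub0mx.
have /eqP : w i * (b - (a i *m c) 0 0) = 0.
  by apply: (psumr_eq0P _ H) => // j _; rewrite mulr_ge0 ?subr_ge0.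
by rewrite mulf_eq0 subr_eq0 [b == _]eq_sym -JE (negbTE iJ) orbF => /eqP.
Qed.

Lemma is_face_hull a F : is_face (convex_hull (range a)) F -> exists2 J, F = face_hull a J &
  exists (c : 'cV[R]_d) b,
  (forall i, (a i *m c) 0 0 <= b) /\ (forall i, (i \in J) = ((a i *m c) 0 0 == b)).
Proof.
case=> c [b [Hle ->]]; pose J := [set i | (a i *m c) 0 0 == b]%SET.
have Hi i : (a i *m c) 0 0 <= b by apply/Hle/point_in_hull.
have JE i : (i \in J) = ((a i *m c) 0 0 == b) by rewrite inE.
by exists J; [case: (face_hullE Hi JE)|exists c, b].
Qed.

Lemma face_hull_basis a J : exists2 J' : {set 'I_N}, #|J'| = \rank (homog_mx a J) &
  (homog_mx a J' :=: homog_mx a J)%MS.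
Proof.
pose f := maxrankfun (homog_mx a J); pose g j := enum_val (f j).
have gi : injective g by move=> i j /enum_val_inj/maxrankfun_inj.
exists [set g j | j : 'I_(\rank (homog_mx a J))]%SET.
  by rewrite card_imset // card_ord.
apply/eqmxP/andP; split.
  apply: homog_mx_subP => _ /imsetP[j _ ->]; apply: homog_mx_mem.
  exact: enum_valP.
rewrite -(eq_maxrowsub (homog_mx a J)); apply/row_subP => j.
by rewrite row_rowsub rowK homog_mx_mem //; apply/imsetP; exists j.
Qed.

(** A basis chosen among the homogenized points on the face has k+1 elements. Hence there are never
    more than ['C(N, k.+1)] k-faces. *)
Lemma kface_hull k a F : faces k (convex_hull (range a)) F ->
  exists2 J : {set 'I_N}, #|J| = k.+1 & F = face_hull a J.
Proof.
case=> /is_face_hull[T ->] _ /(has_affine_dim_homog k (affine_hull_face a T)).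
move=> rT; have [J JT JE] := face_hull_basis a T.
by exists J; [rewrite JT|apply/seteqP; split => y [Qy /= Hy]; split => //=;
  rewrite -?JE // JE].
Qed.

Lemma face_hull_kface k a J (c : 'cV[R]_d) b : #|J| = k.+1 ->
  row_free (homog_mx a J) ->
  (forall i, (a i *m c) 0 0 <= b) -> (forall i, (i \in J) = ((a i *m c) 0 0 == b)) ->
  faces k (convex_hull (range a)) (face_hull a J).
Proof.
move=> Jk Jf le_b JE; split.
  by have [H <-] := face_hullE le_b JE; exists c, b.
by apply/(has_affine_dim_homog k (affine_hull_face a J)); rewrite -Jk; exact/eqP.
Qed.

Lemma face_hull_sub a J J' (c : 'cV[R]_d) b :
  (forall i, (i \in J) = ((a i *m c) 0 0 == b)) ->
  face_hull a J' `<=` face_hull a J -> J' \subset J.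
Proof.
move=> JE J'J; apply/fintype.subsetP => i /(face_hull_point a)/J'J[_ /= ai].
by rewrite JE; apply/eqP; apply: (homog_sub_eq _ ai) => j; rewrite JE => /eqP.
Qed.

(** Here [face_hull a] is a bijection from the (k+1)-sets onto the k-faces: the supporting
    inequality of a face recovers its index set. *)
Lemma kfaces_card k a :
  (forall J, #|J| = k.+1 -> row_free (homog_mx a J) /\ exists (c : 'cV[R]_d) b,
     (forall i, (a i *m c) 0 0 <= b) /\ (forall i, (i \in J) = ((a i *m c) 0 0 == b))) ->
  (faces k (convex_hull (range a)) #= `I_'C(N, k.+1))%card.
Proof.
move=> H; pose D := [set J : {set 'I_N} | #|J| == k.+1]%SET.
have -> : faces k (convex_hull (range a)) = face_hull a @` [set` D].
  apply/seteqP; split => [F /kface_hull[J Jk ->]|_ [J /= JD <-]].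
    by exists J => //=; rewrite inE Jk.
  rewrite inE in JD; move/eqP: JD => Jk.
  have [Jf [c [b [le_b JE]]]] := H J Jk.
  exact: face_hull_kface Jk Jf le_b JE.
have DE : #|D| = 'C(N, k.+1) by rewrite card_draws card_ord.
apply: (@card_eq_trans _ _ _ _ [set` D]).
  apply: inj_card_eq => J J'; rewrite !in_setE /= !inE => /eqP Jk /eqP J'k JJ'.
  have [_ [c [b [_ JE]]]] := H J Jk.
  apply/esym/eqP; rewrite eqEcard Jk J'k leqnn andbT.
  by apply: (face_hull_sub JE); rewrite JJ'.
rewrite -DE card_eq_sym.
have -> : [set` D] = nth finset.set0 (enum D) @` `I_#|D|.
  apply/seteqP; split => [J /=|_ [i /= iD <-]].
    by rewrite -mem_enum => /(nthP finset.set0)[i]; rewrite -cardE; exists i.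
  by rewrite -mem_enum mem_nth // -cardE.
rewrite card_eq_sym; apply: inj_card_eq => i j; rewrite !in_setE /= cardE => iD jD.
by move/eqP; rewrite nth_uniq ?enum_uniq // => /eqP.
Qed.

(* [face_hull a] maps the (k+1)-sets onto a set containing all k-faces; if there
   are as many k-faces as (k+1)-sets, it is a bijection onto the k-faces, and a
   further vertex on a face could be exchanged, contradicting injectivity. *)
Lemma card_kfaces k a :
  (faces k (convex_hull (range a)) #= `I_'C(N, k.+1))%card ->
  forall J, #|J| = k.+1 -> row_free (homog_mx a J) /\ exists (c : 'cV[R]_d) b,
     (forall i, (a i *m c) 0 0 <= b) /\ (forall i, (i \in J) = ((a i *m c) 0 0 == b)).
Proof.
rewrite card_eq_sym => /card_set_bijP[f [fF fI _]].
pose D := [set J : {set 'I_N} | #|J| == k.+1]%SET.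
have DE : #|D| = 'C(N, k.+1) by rewrite card_draws card_ord.
have fJ (i : 'I_('C(N, k.+1))) :
    exists2 J : {set 'I_N}, #|J| = k.+1 & f i = face_hull a J.
  by apply: kface_hull; apply: fF => /=.
pose g i := sval (cid2 (fJ i)).
have gk i : #|g i| = k.+1 by rewrite /g; case: cid2.
have gE (i : 'I_('C(N, k.+1))) : f i = face_hull a (g i) by rewrite /g; case: cid2.
have gI : injective g.
  move=> i j gij; apply/val_inj/fI; rewrite ?inE //=.
  by rewrite !gE gij.
have gD J : #|J| = k.+1 -> exists i, J = g i.
  move=> Jk; have /setP/(_ J) : [set g i | i : 'I_('C(N, k.+1))]%SET = D.
    apply/eqP; rewrite eqEcard card_imset // card_ord DE leqnn andbT.
    by apply/fintype.subsetP => _ /imsetP[i _ ->]; rewrite inE gk.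
  by rewrite inE Jk eqxx => /imsetP[i _ ->]; exists i.
have face_hull_inj J J' : #|J| = k.+1 -> #|J'| = k.+1 ->
    face_hull a J = face_hull a J' -> J = J'.
  by move=> /gD[i ->] /gD[j ->]; rewrite -!gE => /fI ij; congr g; apply/val_inj/ij; rewrite inE /=.
have face_rank J : #|J| = k.+1 -> row_free (homog_mx a J).
  move=> Jk; have [i Ji] := gD J Jk.
  have [_] : faces k (convex_hull (range a)) (f i) by apply: fF => /=.
  rewrite gE -Ji => /(has_affine_dim_homog k (affine_hull_face a J)) rJ.
  by apply/eqP; rewrite rJ Jk.
move=> J Jk; split; first exact: face_rank.
have [i Ji] := gD J Jk.
have [+ _] : faces k (convex_hull (range a)) (f i) by apply: fF => /=.
rewrite gE -Ji => /is_face_hull[T JT [c [b [le_b TE]]]]; exists c, b; split => // i0.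
rewrite -TE; apply/idP/idP => [i0J|i0T].
  have : face_hull a T (a i0) by rewrite -JT; exact: face_hull_point.
  by case=> _ /= ai0; rewrite TE; apply/eqP/(homog_sub_eq _ ai0) => j; rewrite TE => /eqP.
apply/negPn/negP => i0J.
have ai0 : (homog (a i0) <= homog_mx a J)%MS.
  by have := face_hull_point a i0T; rewrite -JT => -[].
have [j jJ] : exists j, j \in J by apply/card_gt0P; rewrite Jk.
pose J' := (i0 |: (J :\ j))%SET.
have i0j : i0 \notin (J :\ j)%SET by rewrite inE (negbTE i0J) andbF.
have J'k : #|J'| = k.+1 by rewrite cardsU1 i0j -Jk (cardsD1 j J) jJ.
have J'J : (homog_mx a J' <= homog_mx a J)%MS.
  apply: homog_mx_subP => l /setU1P[->//|/setD1P[_ lJ]]; exact: homog_mx_mem.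
have JJ' : (homog_mx a J <= homog_mx a J')%MS.
  have [_ <-] := mxrank_leqif_sup J'J.
  by rewrite (eqP (face_rank J Jk)) (eqP (face_rank J' J'k)); apply/eqP; rewrite Jk J'k.
have /(face_hull_inj J' J J'k Jk) J'E : face_hull a J' = face_hull a J.
  apply/seteqP; split => y [Qy /= Hy]; split => //=; exact: submx_trans Hy _.
by move: i0J; rewrite -J'E setU11.
Qed.

End face_hull.

(** * Gale duality *)

Section gale.
Context {R : realType} {d N : nat}.
Implicit Types (a : 'I_N -> 'rV[R]_d) (J : {set 'I_N}).

Definition homog_all a : 'M[R]_(N, 1 + d) := \matrix_i homog (a i).

Lemma mul_homog_all a (l : 'rV[R]_N) :
  l *m homog_all a = row_mx (\sum_i l 0 i)%:M (\sum_i l 0 i *: a i).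
Proof. by rewrite mulmx_sum_row -homog_comb; apply: eq_bigr => i _; rewrite rowK. Qed.

Lemma affine_dependenceP a (l : 'rV[R]_N) :
  affine_dependence a l <-> l *m homog_all a = 0.
Proof.
rewrite mul_homog_all; split=> [[-> ->]|]; first by rewrite raddf0 row_mx0.
rewrite -[RHS](row_mx0 _ 1 1 d) => /eq_row_mx[].
by move=> /matrixP/(_ 0 0); rewrite !mxE eqxx mulr1n => l0 lA; split.
Qed.

Variables (a : 'I_N -> 'rV[R]_d) (abar : 'I_N -> 'rV[R]_(N - d - 1)).
Hypothesis gt : gale_transform a abar.

Let B : 'M[R]_(N - d - 1, N) := \matrix_(j, i) abar i 0 j.

Let BP (l : 'rV[R]_N) : (l <= B)%MS <-> l *m homog_all a = 0.
Proof. by case: gt => _ _ /(_ l) ->; exact: affine_dependenceP. Qed.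

Let BE (u : 'rV[R]_(N - d - 1)) i : (u *m B) 0 i = dotv u (abar i).
Proof. by rewrite mxE; apply: eq_bigr => j _; rewrite mxE. Qed.

(* Values of affine functions on the points are the linear dependences of the
   Gale transform. *)
Lemma gale_functional (h : 'I_N -> R) : \sum_i h i *: abar i = 0 ->
  exists (c : 'cV[R]_d) b, forall i, h i = b - (a i *m c) 0 0.
Proof.
move=> habar; pose hr : 'rV[R]_N := \row_i h i.
have hB : hr *m B^T = 0.
  apply/rowP => j; rewrite !mxE.
  move/rowP/(_ j): habar; rewrite summxE [in RHS]mxE => E; rewrite -[RHS]E.
  by apply: eq_bigr => i _; rewrite !mxE.
have : (hr <= (homog_all a)^T)%MS.
  rewrite submxE; apply/eqP.
  (* The vectors annihilating all values of affine functions on the points are the affine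
     dependences, i.e. combinations of the rows of [B], and these annihilate [hr] as well. *)
  have /submxP[X XE] : ((cokermx (homog_all a)^T)^T <= B)%MS.
    apply/row_subP => i; apply/BP; rewrite -row_mul; apply/rowP => j.
    by rewrite -[_ *m _]trmxK trmx_mul trmxK mulmx_coker !mxE.
  by rewrite -[cokermx _]trmxK XE trmx_mul mulmxA hB mul0mx.
case/submxP => D DE; exists (- (rsubmx D)^T), (lsubmx D 0 0) => i.
have -> : h i = hr 0 i by rewrite mxE.
rewrite DE mulmxN mxE [in X in _ = _ - X]mxE opprK -dotvE dotvC.
transitivity (dotv D (homog (a i))).
  by apply: eq_bigr => j _; rewrite !mxE.
rewrite -[D in LHS]hsubmxK dotv_row_mx; congr (_ + _).
by rewrite /dotv big_ord1 [X in _ * X]mxE eqxx mulr1.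
Qed.

Lemma gale_functionalV (c : 'cV[R]_d) b :
  \sum_i (b - (a i *m c) 0 0) *: abar i = 0.
Proof.
apply/rowP => j; rewrite summxE [RHS]mxE.
have : affine_dependence a (row j B) by case: gt => _ _ <-; exact: row_sub.
case=> Ba B1; transitivity (b * \sum_i row j B 0 i - ((\sum_i row j B 0 i *: a i) *m c) 0 0).
  rewrite mulmx_suml summxE mulr_sumr -sumrB; apply: eq_bigr => i _.
  by rewrite -scalemxAl !mxE mulrBl mulrC; congr (_ - _); rewrite mulrC.
by rewrite Ba B1 mulr0 mul0mx mxE subrr.
Qed.

(** The affine dependences of the points are the vectors [u *m B], with [u] determined by the
    dependence. Such a dependence is supported in [J] exactly when [u] is orthogonal to all [abar i]
    with [i] outside [J]. *)
Lemma gale_free J : row_free (homog_mx a J) <->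
  forall u, (forall i, i \notin J -> dotv u (abar i) = 0) -> u = 0.
Proof.
have [_ Bf _] := gt; split=> [Jf u uJ|H].
  pose l := u *m B.
  have lM : l *m homog_all a = 0 by apply/BP; exact: submxMl.
  pose v : 'rV[R]_#|J| := \row_j l 0 (enum_val j).
  have : v *m homog_mx a J = 0.
    rewrite -[RHS]lM !mulmx_sum_row (bigID [in J]) /= [X in _ = _ + X]big1 => [|i iJ].
      rewrite addr0 [RHS]big_enum_val; apply: eq_bigr => j _.
      by rewrite !rowK mxE.
    by rewrite BE uJ ?scale0r.
  move/eqP; rewrite mulmx_free_eq0 // => /eqP v0.
  apply/eqP; rewrite -(mulmx_free_eq0 _ Bf); apply/eqP/rowP => i; rewrite [RHS]mxE.
  have [iJ|iJ] := boolP (i \in J); last by rewrite BE uJ.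
  by move/rowP/(_ (enum_rank_in iJ i)): v0; rewrite !mxE enum_rankK_in.
apply: inj_row_free => v vJ.
pose S : 'M[R]_(#|J|, N) := \matrix_(j, i) (i == enum_val j)%:R.
have SJ : S *m homog_all a = homog_mx a J.
  apply/row_matrixP => j; rewrite row_mul mulmx_sum_row rowK (bigD1 (enum_val j)) //=.
  rewrite !mxE eqxx scale1r rowK big1 ?addr0 // => i /negbTE ij.
  by rewrite !mxE ij scale0r.
have /BP/submxP[u uE] : v *m S *m homog_all a = 0 by rewrite -mulmxA SJ.
have u0 : u = 0.
  apply: H => i iJ; rewrite -BE -uE mxE big1 // => j _; rewrite mxE.
  case: eqP => [iE|]; last by rewrite mulr0.
  by move: iJ; rewrite iE enum_valP.
apply/rowP => j; move/rowP/(_ (enum_val j)): uE; rewrite u0 mul0mx !mxE => <-.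
rewrite (bigD1 j) //= mxE eqxx mulr1 big1 ?addr0 // => i ij.
by rewrite mxE (inj_eq enum_val_inj) eq_sym (negbTE ij) mulr0.
Qed.

End gale.

(** The slacks of an inequality tight exactly on [J] are the coefficients of a strictly positive
    dependence of the Gale vectors outside [J]. Together with linear spanning, which is dual to
    affine independence on [J], this amounts to positive spanning. *)
Lemma gale_kfaces (R : realType) d N k (a : 'I_N -> 'rV[R]_d)
    (x : 'I_N -> 'rV[R]_(N - d - 1)) (lam : 'I_N -> R) :
  (forall i, 0 < lam i) -> gale_transform a (fun i => lam i *: x i) ->
  (faces k (convex_hull (range a)) #= `I_'C(N, k.+1))%card <->
  forall J : {set 'I_N}, #|J| = k.+1 -> positively_spans (~: J) x.
Proof.
move=> lam0 gt; split.
  move=> /card_kfaces H J /H[/(gale_free gt) Jf [c [b [le_b JE]]]] u u0.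
  apply: contrapT => Hu; move/eqP: u0; apply; apply: Jf => i iJ.
  have {}Hu j : j \notin J -> dotv u (x j) <= 0.
    by move=> jJ; rewrite leNgt; apply/negP => uj; apply: Hu; exists j; rewrite ?inE.
  have bJ j : j \notin J -> 0 < b - (a j *m c) 0 0.
    by move=> jJ; rewrite subr_gt0 lt_neqAle le_b andbT -JE.
  (* Paired with [u], the terms of the slack dependence are non-positive and sum to 0, so [u] is
     orthogonal to every [x i] outside [J]. *)
  have := congr1 (dotv u) (gale_functionalV gt c b); rewrite dotv0r dotv_sumr.
  rewrite (bigID [in J]) /= big1 => [|j]; last first.
    by rewrite JE => /eqP->; rewrite subrr scale0r dotv0r.
  rewrite add0r => H0.
  have /eqP : - dotv u ((b - (a i *m c) 0 0) *: (lam i *: x i)) = 0.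
    have := H0; move/(congr1 -%R); rewrite -sumrN oppr0 => {}H0.
    apply: (psumr_eq0P _ H0) => // j jJ; rewrite !dotvZr oppr_ge0.
    by rewrite mulr_ge0_le0 ?(ltW (bJ _ jJ)) // mulr_ge0_le0 ?Hu // ltW.
  rewrite oppr_eq0 dotvZr mulf_eq0 (gt_eqF (bJ _ iJ)) /= => /eqP->.
  by [].
move=> H; apply: kfaces_card => J Jk; have xJ := H J Jk; split.
  apply/(gale_free gt) => u Hu; apply: contrapT => /eqP/xJ[i].
  rewrite inE => iJ; have /eqP := Hu i iJ.
  by rewrite dotvZr mulf_eq0 (gt_eqF (lam0 i)) /= => /eqP->; rewrite ltxx.
have [h h0 hx] := positively_spans_dependence xJ.
(* Division by [lam i] carries the dependence over to the rescaled vectors; the zeros on [J] become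
   the tight indices. *)
pose h' i := if i \in J then 0 else h i / lam i.
have [|c [b hE]] := gale_functional gt (h := h').
  rewrite (bigID [in J]) /= big1 ?add0r => [|i]; last first.
    by rewrite /h' => ->; rewrite scale0r.
  rewrite -[RHS]hx; apply: eq_big => i; first by rewrite inE.
  by rewrite /h' => /negbTE->; rewrite scalerA divfK // gt_eqF.
have h'0 i : i \notin J -> 0 < h' i.
  by move=> iJ; rewrite /h' (negbTE iJ) divr_gt0 // h0 // inE.
exists c, b; split => i.
  rewrite -subr_ge0 -hE; have [iJ|/h'0/ltW//] := boolP (i \in J).
  by rewrite /h' iJ.
rewrite eq_sym -subr_eq0 -hE; have [iJ|/h'0/gt_eqF->//] := boolP (i \in J).
by rewrite /h' iJ eqxx.
Qed.

(** The space [K] of linear dependences of the [abar i] has dimension d+1 and contains the all-ones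
    row, since the vectors sum to 0. Completing that row to a basis of [K] gives d further rows,
    which are the coordinates of the points. *)
Lemma gale_transform_exists (R : realType) d N (abar : 'I_N -> 'rV[R]_(N - d - 1)) :
  (d < N - 1)%N -> \sum_i abar i = 0 ->
  (forall u, (forall i, dotv u (abar i) = 0) -> u = 0) ->
  exists a : 'I_N -> 'rV[R]_d, gale_transform a abar.
Proof.
move=> dN sum0 span; pose B : 'M[R]_(N - d - 1, N) := \matrix_(j, i) abar i 0 j.
have Bf : row_free B.
  apply: inj_row_free => u uB; apply: span => i.
  by move/rowP/(_ i): uB; rewrite !mxE => E; rewrite -[RHS]E; apply: eq_bigr => j _; rewrite mxE.
pose K := kermx B^T; pose one : 'rV[R]_N := const_mx 1.
have oneK : (one <= K)%MS.
  apply/sub_kermxP/rowP => j; rewrite !mxE.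
  move/rowP/(_ j): sum0; rewrite summxE [in RHS]mxE => E; rewrite -[RHS]E.
  by apply: eq_bigr => i _; rewrite !mxE mul1r.
have rone : \rank one = 1%N.
  have N0 : (0 < N)%N by exact: leq_trans (leq_ltn_trans _ dN) (leq_subr 1 N).
  rewrite rank_rV; case: eqP => // /rowP/(_ (Ordinal N0)).
  by rewrite !mxE => /eqP; rewrite oner_eq0.
have rC : \rank (K :\: one) = d.
  have := mxrank_cap_compl K one.
  rewrite (capmx_idPr oneK) rone mxrank_ker mxrank_tr (eqP Bf) => E.
  by lia.
have [A AE] : exists A : 'M[R]_(d, N), (A :=: (K :\: one)%MS)%MS.
  by rewrite -rC; exists (row_base (K :\: one)%MS); exact: eq_row_base.
have KE : (col_mx one A :=: K)%MS.
  apply/eqmxP/andP; split.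
    by rewrite col_mx_sub oneK AE diffmxSl.
  rewrite -(addsmx_diff_cap_eq K one) addsmx_sub (capmx_idPr oneK).
  by rewrite -!addsmxE addsmxSl -AE addsmxSr.
pose a i : 'rV[R]_d := row i A^T; exists a.
have aE : homog_all a = (col_mx one A)^T.
  apply/row_matrixP => i; rewrite rowK tr_col_mx row_row_mx; congr row_mx.
  by apply/rowP => j; rewrite !mxE [j]ord1 eqxx.
split=> //.
  apply/seteqP; split => // y _; have Mfull : row_full (homog_all a).
    rewrite /row_full aE mxrank_tr KE mxrank_ker mxrank_tr (eqP Bf).
    by lia.
  have /submxP[D] : (homog y <= homog_all a)%MS by exact: submx_full.
  rewrite mul_homog_all => /eq_row_mx[D1 ->]; exists N, (D 0), a; split => //.
  by move/matrixP/(_ 0 0): D1; rewrite !mxE eqxx => E; exact: esym E.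
move=> l; rewrite affine_dependenceP aE.
have -> : (l *m (col_mx one A)^T = 0) <-> (K *m l^T = 0).
  split=> [E|E].
    have /submxP[X ->] : (K <= col_mx one A)%MS by rewrite KE.
    by rewrite -mulmxA -[_ *m l^T]trmxK trmx_mul trmxK E trmx0 mulmx0.
  have /submxP[X ->] : (col_mx one A <= K)%MS by rewrite KE.
  by rewrite trmx_mul mulmxA -[l *m _]trmxK trmx_mul trmxK E trmx0 mul0mx.
split=> [/submxP[D ->]|E].
  by rewrite trmx_mul mulmxA mulmx_ker mul0mx.
rewrite submxE; apply/eqP.
have /submxP[X XE] : ((cokermx B)^T <= K)%MS.
  by apply/sub_kermxP; rewrite -trmx_mul mulmx_coker trmx0.
by rewrite -[cokermx B]trmxK XE -[l]trmxK -trmx_mul -mulmxA E mulmx0 trmx0.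
Qed.

Lemma face_number_isP (R : realType) d N k
    (x : N.-tuple ((N - d - 1).-tuple R)) : (k < N)%N -> (d < N - 1)%N ->
  face_number_is k (@gale_polytopes R d N x) 'C(N, k.+1) <->
  forall J : {set 'I_N}, #|J| = k.+1 ->
    positively_spans (~: J) (fun i => vec (tnth x i)).
Proof.
move=> kN dN; split=> [[[Q CQ] HC]|H].
  have := HC Q CQ; case: CQ => lam [a [lam0 _ gt ->]].
  by move=> /(gale_kfaces k lam0 gt).
split; last first.
  move=> _ [lam [a [lam0 _ gt ->]]]; exact/(gale_kfaces k lam0 gt).
(* One (k+1)-set suffices for the class to be inhabited: positive spanning by its complement passes
   to the whole family and supplies [lam] and [a]. *)
have [J Jk] : exists J : {set 'I_N}, #|J| = k.+1.
  have : (0 < #|[set A : {set 'I_N} | #|A| == k.+1]%SET|)%N.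
    by rewrite card_draws card_ord bin_gt0.
  by case/card_gt0P => J; rewrite inE => /eqP Jk; exists J.
have xT : positively_spans [set: 'I_N] (fun i => vec (tnth x i)).
  by move=> u /(H J Jk)[i _]; exists i; rewrite ?inE.
have [lam lam0 lamx] := positively_spans_dependence xT.
have {}lam0 i : 0 < lam i by rewrite lam0 ?inE.
have {}lamx : \sum_i lam i *: vec (tnth x i) = 0.
  by rewrite -[RHS]lamx; apply: eq_bigl => i; rewrite inE.
have [|a gt] := gale_transform_exists dN lamx.
  move=> u Hu; apply: contrapT => /eqP/xT[i _].
  have /eqP := Hu i; rewrite dotvZr mulf_eq0 gt_eqF //= => /eqP->.
  by rewrite ltxx.
by exists (convex_hull (range a)), lam, a.
Qed.

(** * Counting sign patterns *)

(** The number of cells cut out by [n] hyperplanes through the origin in general position in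
    dimension [r]. *)
Fixpoint cover_count (n r : nat) : nat :=
  match n, r with
  | 0, _ => 1
  | _.+1, 0 => 0
  | n'.+1, r'.+1 => cover_count n' r + cover_count n' r'
  end.

Lemma cover_countE n r : cover_count n.+1 r = (2 * \sum_(i < r) 'C(n, i))%N.
Proof.
elim: n r => [|n IH] [|r]; rewrite ?big_ord0 ?muln0 //.
  by rewrite big_ord_recl big1 // => i _; rewrite bin_small.
have -> : cover_count n.+2 r.+1 = (cover_count n.+1 r.+1 + cover_count n.+1 r)%N by [].
rewrite !IH -mulnDr; congr (_ * _)%N.
rewrite big_ord_recl [RHS]big_ord_recl !bin0 -addnA; congr addn.
under [RHS]eq_bigr do rewrite /= /bump add1n binS.
by rewrite big_split.
Qed.

Definition sign_flip (R : realType) (m : nat) (I : finType) (A : {set I})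
    (x : I -> 'rV[R]_m) : I -> 'rV[R]_m :=
  fun i => if i \in A then - x i else x i.

Section cover.
Context {R : realType} {m : nat} {I : finType}.
Variable x : I -> 'rV[R]_m.

(** The subspace [W] is a parameter so that the induction can pass to a hyperplane inside it. *)
Let cell (W : 'M[R]_m) (D A : {set I}) : Prop :=
  exists2 u, (u <= W)%MS & forall i, i \in D -> 0 < dotv u (sign_flip A x i).

Let cells (W : 'M[R]_m) (D : {set I}) : {set {set I}} :=
  [set A in powerset D | `[< cell W D A >]]%SET.

(* Cover's recursion: a cell of the arrangement without [i0] is cut by the
   hyperplane orthogonal to [x i0] iff it induces a cell inside it. *)
Lemma cover_bound (W : 'M[R]_m) (D : {set I}) :
  (#|cells W D| <= cover_count #|D| (\rank W))%N.
Proof.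
have [n Dn] := ubnP #|D|; elim: n => // n IH in W D Dn *.
have [->|[i0 i0D]] := set_0Vmem D.
  rewrite cards0 /=; apply: leq_trans (subset_leq_card _) _.
    by apply/fintype.subsetP => A; rewrite inE => /andP[+ _]; exact: id.
  by rewrite card_powerset cards0.
pose D' := (D :\ i0)%SET.
have D'D i : i \in D' -> i \in D by rewrite inE => /andP[].
have DE : #|D| = #|D'|.+1 by rewrite (cardsD1 i0) i0D.
have {}Dn : (#|D'| < n)%N by rewrite DE in Dn.
(* A cell provides some [u0] in [W] not orthogonal to [x i0], so that cutting [W] by the hyperplane
   lowers its rank by exactly one. *)
have [->|[A0]] := set_0Vmem (cells W D); first by rewrite cards0.
rewrite inE => /andP[_ /asboolP[u0 u0W u0D]].
pose f := x i0.
have u0f : dotv u0 f != 0.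
  have := u0D _ i0D; rewrite /sign_flip; case: ifP => _; last by move/lt0r_neq0.
  by rewrite dotvNr => /lt0r_neq0; rewrite oppr_eq0.
pose W' := (W :&: kermx f^T)%MS.
have rW : \rank W = (\rank W').+1.
  rewrite -(mxrank_mul_ker W f^T) -[RHS]add1n; congr addn.
  apply/eqP; rewrite eqn_leq rank_leq_col lt0n mxrank_eq0; apply: contra u0f => /eqP Wf.
  by have /submxP[X ->] := u0W; rewrite dotvE -mulmxA Wf mulmx0 mxE.
pose P := [set A in cells W D | i0 \notin A]%SET.
pose Q := [set A :\ i0 | A in [set A in cells W D | i0 \in A]]%SET.
have PP A : A \in P -> A \subset D' /\
    exists u, [/\ (u <= W)%MS, forall i, i \in D' -> 0 < dotv u (sign_flip A x i)
                & 0 < dotv u f].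
  rewrite !inE => /andP[/andP[AD /asboolP[u uW uD]] i0A]; split.
    by rewrite subsetD1 AD.
  exists u; split => // [i /D'D|]; first exact: uD.
  by have := uD _ i0D; rewrite /sign_flip (negbTE i0A).
have QQ A : A \in Q -> A \subset D' /\
    exists u, [/\ (u <= W)%MS, forall i, i \in D' -> 0 < dotv u (sign_flip A x i)
                & dotv u f < 0].
  case/imsetP => B; rewrite !inE => /andP[/andP[BD /asboolP[u uW uD]] i0B] ->; split.
    by rewrite finset.setSD.
  exists u; split => // [i iD'|].
    have := uD i (D'D i iD'); move: iD'; rewrite /sign_flip !inE.
    by case/andP => -> _.
  by have := uD _ i0D; rewrite /sign_flip i0B dotvNr oppr_gt0.
have cellsI (A : {set I}) u : A \subset D' -> (u <= W)%MS ->
    (forall i, i \in D' -> 0 < dotv u (sign_flip A x i)) -> A \in cells W D'.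
  by move=> AD uW uD; rewrite !inE AD /=; apply/asboolP; exists u.
have -> : #|cells W D| = (#|P| + #|Q|)%N.
  rewrite card_in_imset => [|A A']; last first.
    rewrite !inE => /andP[_ iA] /andP[_ iA'] AA'.
    by rewrite -(finset.setD1K iA) -(finset.setD1K iA') AA'.
  rewrite -(cardsID [set A : {set I} | i0 \in A] (cells W D)) addnC; congr addn.
    by apply: eq_card => A; rewrite !inE andbC.
  by apply: eq_card => A; rewrite !inE.
(* The union of [P] and [Q] consists of cells for [D'] in [W], their intersection of cells for [D']
   in the hyperplane [W']. *)
rewrite -cardsUI DE rW; apply: leq_add.
  rewrite -rW; apply: leq_trans (IH W D' Dn); apply: subset_leq_card.
  apply/fintype.subsetP => A /setUP[/PP|/QQ] [AD [u [uW uD _]]]; exact: cellsI AD uW uD.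
apply: leq_trans (IH W' D' Dn); apply: subset_leq_card.
apply/fintype.subsetP => A /setIP[/PP[AD [u [uW uD uf]]] /QQ[_ [v [vW vD vf]]]].
rewrite !inE AD /=; apply/asboolP.
(* This combination of vectors on both sides of the hyperplane is orthogonal to [f]; its
   coefficients are positive, so it stays in the cell. *)
exists (- dotv v f *: u + dotv u f *: v).
  rewrite sub_capmx addmx_sub ?scalemx_sub //=; apply/sub_kermxP/rowP => j.
  rewrite [j]ord1 -dotvE dotvDl !dotvZl mxE mulNr [dotv u f * _]mulrC.
  by rewrite addrC subrr.
move=> i iD'; rewrite dotvDl !dotvZl addr_gt0 // mulr_gt0 ?uD ?vD //.
by rewrite oppr_gt0.
Qed.

Lemma open_halfspace_flip_count (D : {set I}) : (#|
  [set A in powerset D | `[< open_halfspace D (sign_flip A x) >]]%SET|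
  <= cover_count #|D| m)%N.
Proof.
have := cover_bound 1%:M D; rewrite mxrank1; apply: leq_trans.
apply: subset_leq_card; apply/fintype.subsetP => A; rewrite !inE => /andP[-> /=].
by move=> /asboolP[u Hu]; apply/asboolP; exists u; rewrite ?submx1.
Qed.

End cover.

(** * Measurability *)

Section measurable_sets.
Context {d} {T : measurableType d}.

Lemma measurable_ex (I : countType) (P : I -> set T) :
  (forall i, measurable (P i)) -> measurable [set x | exists i, P i x].
Proof.
move=> mP; rewrite (_ : [set x | _] = \bigcup_i P i).
  by apply: countable_bigcupT_measurable => //; exact: countableP.
by apply/seteqP; split => x [i]; exists i.
Qed.

Lemma measurable_all (I : countType) (P : I -> set T) :
  (forall i, measurable (P i)) -> measurable [set x | forall i, P i x].
Proof.
move=> mP; rewrite (_ : [set x | _] = ~` [set x | exists i, (~` P i) x]).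
  by apply: measurableC; apply: measurable_ex => i; exact: measurableC.
apply/seteqP; split => x /=; first by move=> Px [i].
by move=> nP i; apply: contrapT => nPi; apply: nP; exists i.
Qed.

Lemma measurable_imply (Q : Prop) (P : set T) :
  measurable P -> measurable [set x | Q -> P x].
Proof.
move=> mP; have [q|nq] := pselect Q.
  by rewrite (_ : [set x | _] = P) //; apply/seteqP; split => x //=; apply.
by rewrite (_ : [set x | _] = setT) //; apply/seteqP; split => // x _ /nq.
Qed.

Lemma measurable_lt_fun (R : realType) (f g : T -> R) :
  measurable_fun setT f -> measurable_fun setT g ->
  measurable [set x | f x < g x].
Proof.
move=> mf mg; have mlt := measurable_fun_ltr mf mg.
by rewrite -[[set x | _]]setTI; exact: (mlt measurableT [set true]).
Qed.

End measurable_sets.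

Section approximation.
Context {R : realType}.

(** Approximation from above keeps non-negative coefficients non-negative, as positive spanning
    requires. *)
Lemma rat_above (I : finType) (c : I -> R) (e : R) : 0 < e ->
  exists q : {ffun I -> rat}, forall i, c i < ratr (q i) < c i + e.
Proof.
move=> e0; have H i : exists q : rat, c i < ratr q < c i + e.
  have [q] := @rat_in_itvoo R (c i) (c i + e) (ltr_pwDr e0 (lexx _)).
  by rewrite in_itv; exists q.
by exists [ffun i => sval (cid (H i))] => i; rewrite ffunE; case: cid.
Qed.

Lemma dist_sum (I : finType) (A : {set I}) (c q : I -> R) (x : I -> R) (e : R) :
  (forall i, c i < q i < c i + e) ->
  `|\sum_(i in A) c i * x i - \sum_(i in A) q i * x i| <= e * \sum_i `|x i|.
Proof.
move=> cq; rewrite -sumrB; apply: le_trans (ler_norm_sum _ _ _) _.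
rewrite mulr_sumr big_mkcond; apply: ler_sum => i _.
have /andP[c1 c2] := cq i; case: ifP => _; last first.
  by rewrite mulr_ge0 // ltW //; lra.
rewrite -mulrBl normrM ler_wpM2r // distrC ger0_norm; lra.
Qed.

End approximation.

Section measurable_position.
Context {R : realType} {m N : nat}.
Local Notation Omega := (N.-tuple (m.-tuple R)).
Implicit Types (x : Omega) (A : {set 'I_N}).

Definition points x : 'I_N -> 'rV[R]_m := fun i => vec (tnth x i).

Lemma measurable_points i j : measurable_fun setT (fun x => points x i 0 j).
Proof.
under eq_fun do rewrite mxE.
exact: (measurableT_comp (measurable_tnth j) (measurable_tnth i)).
Qed.

Lemma measurable_comb A (c : 'I_N -> R) j :
  measurable_fun setT (fun x => \sum_(i in A) c i * points x i 0 j).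
Proof.
under eq_fun do rewrite -big_enum; apply: measurable_sum => i.
by apply: measurable_funM; [exact: measurable_cst|exact: measurable_points].
Qed.

Lemma measurable_dotv u i : measurable_fun setT (fun x => dotv u (points x i)).
Proof.
apply: measurable_sum => j.
by apply: measurable_funM; [exact: measurable_cst|exact: measurable_points].
Qed.

(** A common bound for the absolute sums over coordinates and over points; the summand 1 makes
    division by it safe. *)
Let size1 x : R := 1 + \sum_i \sum_j `|points x i 0 j|.

Let size1_gt0 x : 0 < size1 x.
Proof. by rewrite ltr_pwDl // sumr_ge0 // => i _; rewrite sumr_ge0. Qed.

Let le_size1 x i : \sum_j `|points x i 0 j| <= size1 x.
Proof.
rewrite /size1 (bigD1 i) //= addrCA lerDl addr_ge0 // sumr_ge0 // => j _.
by rewrite sumr_ge0.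
Qed.

Let le_size1' x j : \sum_i `|points x i 0 j| <= size1 x.
Proof.
rewrite /size1 exchange_big /= (bigD1 j) //= addrCA lerDl addr_ge0 // sumr_ge0 // => l _.
by rewrite sumr_ge0.
Qed.

Lemma measurable_open_halfspace A : measurable [set x | open_halfspace A (points x)].
Proof.
pose S (q : {ffun 'I_m -> rat}) : set Omega :=
  [set x | forall i, i \in A -> 0 < dotv (\row_j ratr (q j)) (points x i)].
have -> : [set x | open_halfspace A (points x)] = [set x | exists q, S q x].
  apply/seteqP; split => x /= [u Hu]; last by exists (\row_j ratr (u j)).
  (* Scaled by [t], the vector [u] takes values at least 1 on all the points, and the rational
     approximation costs at most 1/2. *)
  pose t : R := \sum_(i in A) (dotv u (points x i))^-1.
  have t1 i : i \in A -> 1 <= t * dotv u (points x i).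
    move=> iA; have ui := Hu i iA.
    rewrite -(@mulVf _ (dotv u (points x i))) ?gt_eqF // ler_pM2r //.
    rewrite /t (bigD1 i) //= lerDl sumr_ge0 // => j /andP[jA _].
    by rewrite invr_ge0 ltW // Hu.
  have e0 : 0 < (2 * size1 x)^-1 by rewrite invr_gt0 mulr_gt0.
  have [q Hq] := rat_above (fun j => (t *: u) 0 j) e0.
  exists q => i iA.
  have := dist_sum [set: 'I_m] (fun j => points x i 0 j) Hq.
  have E (v : 'rV[R]_m) : \sum_(j in [set: 'I_m]%SET) v 0 j * points x i 0 j = dotv v (points x i).
    by apply: eq_bigl => j; rewrite inE.
  rewrite E (eq_bigr (fun j => (\row_j (ratr (q j) : R)) 0 j * points x i 0 j)); last first.
    by move=> j _; rewrite !mxE.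
  rewrite E dotvZl => H; have {}H := le_trans H (ler_wpM2l (ltW e0) (le_size1 x i)).
  have e1 : (2 * size1 x)^-1 * size1 x = 2^-1.
    by rewrite invfM -mulrA mulVf ?mulr1 // gt_eqF.
  rewrite e1 in H; have := t1 i iA; have := le_trans (ler_norm _) H; lra.
apply: measurable_ex => q; apply: measurable_all => i; apply: measurable_imply.
by apply: measurable_lt_fun; [exact: measurable_cst|exact: measurable_dotv].
Qed.


(* Vectors close enough to all [e_j] and [- e_j] positively span the space, so
   rational coefficients suffice to witness positive spanning. *)
Lemma measurable_positively_spans A : measurable [set x | positively_spans A (points x)].
Proof.
(* If [u] is non-positive on all approximations, each coordinate of [u] is at most [bound] times its
   l1 norm in absolute value. Summing over the [m] coordinates bounds that norm by m/(m+1) times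
   itself, so [u] is 0. *)
pose bound : R := m.+1%:R^-1; have bound0 : 0 < bound by rewrite invr_gt0.
pose sgd (s : bool) (j l : 'I_m) : R := (-1) ^+ s * (l == j)%:R.
pose S (q : {ffun 'I_N * (bool * 'I_m) -> rat}) : set Omega :=
  [set x | (forall t, 0 <= q t) /\ forall s j l,
    `|\sum_(i in A) ratr (q (i, (s, j))) * points x i 0 l - sgd s j l| < bound].
have -> : [set x | positively_spans A (points x)] = [set x | exists q, S q x].
  apply/seteqP; split => x /=; last first.
    case=> q [q0 Hq] u u0; apply: contrapT => nu.
    have {}nu i : i \in A -> dotv u (points x i) <= 0.
      by move=> iA; rewrite leNgt; apply/negP => ui; apply: nu; exists i.
    pose w s j := \sum_(i in A) (ratr (q (i, (s, j))) : R) *: points x i.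
    have w0 s j : dotv u (w s j) <= 0.
      rewrite /w dotv_sumr; apply: sumr_le0 => i iA.
      by rewrite dotvZr mulr_ge0_le0 ?nu // ler0q.
    have wE s j l : `|w s j 0 l - sgd s j l| < bound.
      have := Hq s j l; rewrite /w summxE.
      by under [in X in _ -> X]eq_bigr do rewrite mxE.
    pose n1 := \sum_l `|u 0 l|.
    have uw s j : `|dotv u (w s j) - (-1) ^+ s * u 0 j| <= bound * n1.
      have -> : (-1) ^+ s * u 0 j = \sum_l u 0 l * sgd s j l.
        rewrite (bigD1 j) //= /sgd eqxx mulr1 mulrC big1 ?addr0 // => l /negbTE->.
        by rewrite !mulr0.
      rewrite -sumrB; apply: le_trans (ler_norm_sum _ _ _) _.
      rewrite /n1 mulr_sumr; apply: ler_sum => l _.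
      by rewrite -mulrBr normrM mulrC ler_wpM2r // ltW.
    have uj j : `|u 0 j| <= bound * n1.
      have := uw false j; have := uw true j; have := w0 false j; have := w0 true j.
      rewrite expr1 expr0 mulN1r mul1r !ler_norml => ? ? /andP[? ?] /andP[? ?].
      by apply/andP; split; lra.
    have n1E : n1 <= m%:R * (bound * n1).
      rewrite {1}/n1; apply: (@le_trans _ _ (\sum_(l < m) bound * n1)).
        by apply: ler_sum => l _.
      by rewrite sumr_const card_ord mulr_natl.
    have n10 : 0 < n1.
      rewrite lt_neqAle sumr_ge0 ?andbT //; apply/negP => /eqP n10.
      move/eqP: u0; apply; apply/rowP => l; rewrite mxE; apply/eqP.
      rewrite -normr_eq0; apply/eqP/(psumr_eq0P _ (esym n10)) => //.
    move: n1E; rewrite mulrA leNgt => /negP; apply.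
    rewrite gtr_pMl // /bound ltr_pdivrMr // mul1r ltr_nat //.
  move=> xA.
  pose tgt s j : 'rV[R]_m := \row_l sgd s j l.
  have [c cP] : exists c : 'I_N * (bool * 'I_m) -> R, (forall t, 0 <= c t) /\
      forall s j, tgt s j = \sum_(i in A) c (i, (s, j)) *: points x i.
    have H (sj : bool * 'I_m) := positively_spansP (tgt sj.1 sj.2) xA.
    exists (fun t => sval (cid2 (H t.2)) t.1); split => [[i sj] /=|s j /=].
      by case: cid2.
    by case: cid2.
  have e0 : 0 < bound / 2 / size1 x by rewrite !divr_gt0.
  have [q Hq] := rat_above c e0; exists q; split => [t|s j l].
    have /andP[/ltW ct _] := Hq t; rewrite -(ler0q R).
    exact: le_trans (cP.1 t) ct.
  have := dist_sum A (fun i => points x i 0 l) (fun i => Hq (i, (s, j))).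
  have -> : \sum_(i in A) c (i, (s, j)) * points x i 0 l = sgd s j l.
    transitivity (tgt s j 0 l); last by rewrite mxE.
    by rewrite cP.2 summxE; apply: eq_bigr => i _; rewrite [RHS]mxE.
  rewrite distrC => H; apply: le_lt_trans H _.
  apply: le_lt_trans (ler_wpM2l (ltW e0) (le_size1' x l)) _.
  by rewrite divfK ?gt_eqF // ltr_pdivrMr // mulr_natr mulr2n ltrDl.
apply: measurable_ex => q; have [q0|nq0] := pselect (forall t, 0 <= q t); last first.
  rewrite (_ : S q = set0); first exact: measurable0.
  by apply/seteqP; split => // x -[q0 _]; case: (nq0 q0).
rewrite (_ : S q = [set x | forall s j l,
    `|\sum_(i in A) ratr (q (i, (s, j))) * points x i 0 l - sgd s j l| < bound]).
  apply: measurable_all => s; apply: measurable_all => j; apply: measurable_all => l.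
  apply: measurable_lt_fun; last exact: measurable_cst.
  apply: measurableT_comp; first exact: normr_measurable.
  by apply: measurable_funB; [exact: measurable_comb|exact: measurable_cst].
by apply/seteqP; split => x; [case|split].
Qed.

(* Dual form of: [v] is in the linear span of the [y i], [i \in A]. *)
Definition in_span (I : finType) (A : {set I}) (y : I -> 'rV[R]_m) (v : 'rV[R]_m) :=
  forall u, (forall i, i \in A -> dotv u (y i) = 0) -> dotv u v = 0.

Lemma in_spanP (I : finType) (A : {set I}) (y : I -> 'rV[R]_m) v :
  in_span A y v -> exists c : I -> R, v = \sum_(i in A) c i *: y i.
Proof.
move=> vA; pose M := \matrix_(j < #|A|) y (enum_val j).
have : (v <= M)%MS.
  rewrite submxE; apply/eqP/matrixP => i0 j; rewrite ord1 [RHS]mxE.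
  transitivity (dotv (row j (cokermx M)^T) v).
    by rewrite dotvC dotvE mxE [in RHS]mxE; apply: eq_bigr => l _; rewrite !mxE.
  apply: vA => i iA; have := mulmx_coker M => /matrixP/(_ (enum_rank_in iA i) j).
  rewrite [in X in _ = X -> _]mxE => E; rewrite -[RHS]E mxE dotvC.
  by apply: eq_bigr => l _; rewrite !mxE enum_rankK_in.
case/submxP => D ->; rewrite mulmx_sum_row.
have [A0|[i0 i0A]] := set_0Vmem A.
  exists (fun=> 0); rewrite [RHS]big1 => [|i _]; last exact: scale0r.
  apply: big1 => j _; have : enum_val j \in finset.set0 by rewrite -A0 enum_valP.
  by rewrite inE.
exists (fun i => D 0 (enum_rank_in i0A i)); rewrite [RHS]big_enum_val.
by apply: eq_bigr => j _; rewrite rowK enum_valK_in.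
Qed.

(** Rational coefficients need not represent [v] exactly, but a span is closed: membership means
    approximation by rational combinations to every precision 1/(n+1). *)
Lemma measurable_in_span A (v : Omega -> 'rV[R]_m) :
  (forall j, measurable_fun setT (fun x => v x 0 j)) ->
  measurable [set x | in_span A (points x) (v x)].
Proof.
move=> mv.
pose S (n : nat) (q : {ffun 'I_N -> rat}) : set Omega := [set x | forall l,
    `|v x 0 l - \sum_(i in A) ratr (q i) * points x i 0 l| < n.+1%:R^-1].
have -> : [set x | in_span A (points x) (v x)] = [set x | forall n, exists q, S n q x].
  apply/seteqP; split => x /= H; last first.
    move=> u Hu; apply/eqP; rewrite -normr_eq0 eq_le normr_ge0 andbT.
    pose n1 := \sum_l `|u 0 l|.
    have n10 : 0 <= n1 by exact: sumr_ge0.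
    have uvn n : `|dotv u (v x)| <= n.+1%:R^-1 * n1.
      have [q Hq] := H n; pose w := \sum_(i in A) (ratr (q i) : R) *: points x i.
      have <- : dotv u (v x - w) = dotv u (v x).
        rewrite dotvDr dotvNr dotv_sumr big1 ?subr0 // => i iA.
        by rewrite dotvZr Hu // mulr0.
      apply: le_trans (ler_norm_sum _ _ _) _.
      rewrite /n1 mulr_sumr; apply: ler_sum => l _.
      rewrite normrM mulrC ler_wpM2r // ltW // 2!mxE summxE.
      by under eq_bigr do rewrite mxE; exact: Hq.
    rewrite leNgt; apply/negP => uv.
    have [n Hn] : exists n : nat, n1 / `|dotv u (v x)| < n.+1%:R.
      by exists (Num.truncn (n1 / `|dotv u (v x)|)); exact: truncnS_gt.
    have := uvn n; rewrite leNgt => /negP; apply.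
    by rewrite mulrC ltr_pdivrMr // mulrC -ltr_pdivrMr.
  have [c vE] := in_spanP H; move=> n; have e0 : 0 < n.+1%:R^-1 / 2 / size1 x by rewrite !divr_gt0.
  have [q Hq] := rat_above c e0; exists q => l.
  have := dist_sum A (fun i => points x i 0 l) Hq.
  have -> : \sum_(i in A) c i * points x i 0 l = v x 0 l.
    by rewrite vE summxE; apply: eq_bigr => i _; rewrite [RHS]mxE.
  move=> {}H; apply: le_lt_trans H _.
  apply: le_lt_trans (ler_wpM2l (ltW e0) (le_size1' x l)) _.
  by rewrite divfK ?gt_eqF // ltr_pdivrMr // mulr_natr mulr2n ltrDl invr_gt0.
apply: measurable_all => n; apply: measurable_ex => q; apply: measurable_all => l.
apply: measurable_lt_fun; last exact: measurable_cst.
apply: measurableT_comp; first exact: normr_measurable.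
by apply: measurable_funB; [exact: mv|exact: measurable_comb].
Qed.

End measurable_position.

(** * Product laws and symmetry *)

Section product_law.
Context {R : realType} {d} {E : measurableType d} {N : nat}.
Local Notation Omega := (N.-tuple E).

(** Boxes are closed under intersection and generate the sigma-algebra, so these values determine
    the measure. A bare set function is allowed so that pushforwards fit. *)
Definition product_law (phi : probability E R) (mu : set Omega -> \bar R) :=
  forall A : 'I_N -> set E, (forall i, measurable (A i)) ->
    mu [set x | forall i, A i (tnth x i)] = (\prod_i phi (A i))%E.

Lemma measurable_box (A : 'I_N -> set E) : (forall i, measurable (A i)) ->
  measurable [set x : Omega | forall i, A i (tnth x i)].
Proof.
move=> mA; apply: measurable_all => i; rewrite -[X in measurable X]setTI.
exact: measurable_tnth.
Qed.

Lemma product_law_unique (phi : probability E R) (mu nu : {measure set Omega -> \bar R}) :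
  mu setT = 1%E -> product_law phi mu -> product_law phi nu ->
  forall S, measurable S -> mu S = nu S.
Proof.
move=> mu1 muP nuP S mS.
pose G : set (set Omega) := [set S | exists2 A : 'I_N -> set E,
  (forall i, measurable (A i)) & S = [set x | forall i, A i (tnth x i)]].
apply: (measure_unique G (fun=> setT)) => //.
- apply/seteqP; split; last first.
    apply: smallest_sub; first exact: sigma_algebra_measurable.
    by move=> _ [A mA ->]; exact: measurable_box.
  apply: smallest_sub; first exact: smallest_sigma_algebra.
  move=> V; rewrite -bigcup_seq => -[i _ [B mB <-]].
  apply: sub_sigma_algebra; exists (fun j => if j == i then B else setT).
    by move=> j; case: ifP.
  apply/seteqP; split => x /=; first by move=> [_ xB] j; case: ifP => // /eqP->.
  by move=> /(_ i); rewrite eqxx.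
- move=> _ _ [A mA ->] [B mB ->]; exists (fun i => A i `&` B i).
    by move=> i; exact: measurableI.
  by apply/seteqP; split => x /=; [case=> Ax Bx i|move=> ABx; split => i; case: (ABx i)].
- move=> _; exists (fun=> setT) => //.
  by apply/seteqP; split.
- exact: bigcup_const.
- by move=> _ [A mA ->]; rewrite muP // nuP.
- by move=> _; rewrite mu1 ltry.
Qed.

Lemma product_law_pushforward d' (T : measurableType d') (phi : probability E R)
    (mu : {measure set Omega -> \bar R}) (nu : {measure set T -> \bar R}) (f : T -> Omega) :
  measurable_fun setT f -> mu setT = 1%E -> product_law phi mu ->
  product_law phi (pushforward nu f) ->
  forall S, measurable S -> nu (f @^-1` S) = mu S.
Proof.
move=> mf mu1 muP fP S mS; apply/esym; rewrite -[RHS]/(pushforward nu f S).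
exact: (product_law_unique mu1 muP fP mS).
Qed.

Definition replace_point (i0 : 'I_N) (p : Omega * E) : Omega :=
  [tuple if i == i0 then p.2 else tnth p.1 i | i < N].

Lemma measurable_replace_point i0 : measurable_fun setT (replace_point i0).
Proof.
apply/measurable_fun_tnthP => i.
rewrite (_ : _ \o _ = fun p => if i == i0 then p.2 else tnth p.1 i); last first.
  by apply/funext => p /=; rewrite tnth_mktuple.
case: (i == i0); first exact: measurable_snd.
exact: (measurableT_comp (measurable_tnth i) measurable_fst).
Qed.

(* Resampling the point [i0] independently does not change the law. *)
Lemma product_law_null (phi : probability E R) (mu : probability Omega R) i0 S :
  product_law phi mu -> measurable S ->
  (forall x : Omega, phi.-negligible [set e | S (replace_point i0 (x, e))]) ->
  mu S = 0%E.
Proof.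
move=> muP mS S0; have mu1 : mu setT = 1%E := probability_setT mu.
rewrite -(product_law_pushforward (nu := (mu \x phi)%E) (measurable_replace_point i0) mu1 muP _ mS).
  rewrite /= /product_measure1 integral0_eq // => x _ /=.
  apply: measure_negligible; last by rewrite xsectionE; exact: S0.
  apply: measurable_xsection; rewrite -[X in measurable X]setTI.
  exact: measurable_replace_point.
move=> A mA; rewrite /pushforward.
pose A' i := if i == i0 then setT else A i.
have mA' i : measurable (A' i) by rewrite /A'; case: ifP.
rewrite (_ : _ @^-1` _ = [set x | forall i, A' i (tnth x i)] `*` A i0); last first.
  apply/seteqP; split => -[x e] /=.
    move=> H; split; last by have := H i0; rewrite tnth_mktuple eqxx.
    move=> i; have := H i; rewrite tnth_mktuple /A'; case: ifP => //.
  case=> H He i; have := H i; rewrite tnth_mktuple /A'.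
  by case: eqP => [->|].
rewrite [LHS]product_measure1E //; last exact: measurable_box.
rewrite [X in (X * _)%E](muP A' mA') [RHS](bigD1 i0) //= (bigD1 i0) //=.
rewrite {1}/A' eqxx probability_setT mul1e muleC.
by congr (_ * _)%E; apply: eq_bigr => i /negbTE ii0; rewrite /A' ii0.
Qed.

End product_law.

(** The sum of the probabilities is the expected number of events that occur, and this number is at
    most [K] everywhere. *)
Lemma sum_measure_le {d} {T : measurableType d} {R : realType} (mu : probability T R)
    (I : finType) (D : {set I}) (S : I -> set T) (K : nat) :
  (forall i, measurable (S i)) ->
  (forall x, #|[set i in D | `[< S i x >]]%SET| <= K)%N ->
  (\sum_(i in D) mu (S i) <= K%:R%:E)%E.
Proof.
move=> mS HK.
have mind i : measurable_fun setT (fun x => (\1_(S i) x)%:E : \bar R).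
  by apply/measurable_EFinP; exact: measurable_indic.
have -> : (\sum_(i in D) mu (S i) = \int[mu]_x \sum_(i <- enum D) (\1_(S i) x)%:E)%E.
  rewrite (ge0_integral_sum mu measurableT mind) => [|i x _]; last first.
    by rewrite lee_fin indicE.
  by rewrite big_enum /=; apply: eq_bigr => i _; rewrite integral_indic // setIT.
have -> : K%:R%:E = (\int[mu]_x cst (K%:R%:E : \bar R) x)%E.
  by rewrite integral_cst // [X in (_ * X)%E](probability_setT mu) mule1.
apply: ge0_le_integral => //.
- by move=> x _; apply: sume_ge0 => i _; rewrite lee_fin indicE.
- by apply: emeasurable_sum.
- move=> x _; rewrite sumEFin lee_fin big_enum /=.
  apply: le_trans (_ : (#|[set i in D | `[< S i x >]]%SET|)%:R <= _); last by rewrite ler_nat HK.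
  rewrite -sum1_card natr_sum big_mkcond [X in _ <= X]big_mkcond /=.
  apply: ler_sum => i _; rewrite finset.inE indicE; case: (i \in D) => //=.
  have -> : `[< S i x >] = (x \in S i) by apply/asboolP/idP; rewrite in_setE.
  by case: (x \in S i).
Qed.

(** * Random points: sign flips and general position *)

Section random_points.
Context {R : realType} {m N : nat}.
Local Notation Omega := (N.-tuple (m.-tuple R)).
Implicit Types (x : Omega) (D A J : {set 'I_N}).

Definition flip_points A x : Omega :=
  [tuple if i \in A then map_tuple -%R (tnth x i) else tnth x i | i < N].

Lemma vecN (e : m.-tuple R) : vec (map_tuple -%R e) = - vec e.
Proof. by apply/rowP => j; rewrite !mxE tnth_map. Qed.

Lemma points_flip A x : points (flip_points A x) = sign_flip A (points x).
Proof.
apply/funext => i; rewrite /points /sign_flip tnth_mktuple.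
by case: ifP => // _; rewrite vecN.
Qed.

Lemma measurable_opp_tuple :
  measurable_fun setT (fun e : m.-tuple R => map_tuple -%R e : m.-tuple R).
Proof.
apply/measurable_fun_tnthP => j.
rewrite (_ : _ \o _ = fun e : m.-tuple R => - tnth e j); last first.
  by apply/funext => e /=; rewrite tnth_map.
by apply: measurableT_comp => //; exact: measurable_tnth.
Qed.

Lemma measurable_flip_points A : measurable_fun setT (flip_points A).
Proof.
apply/measurable_fun_tnthP => i.
rewrite (_ : _ \o _ = fun x : Omega =>
    if i \in A then map_tuple -%R (tnth x i) else tnth x i); last first.
  by apply/funext => x /=; rewrite tnth_mktuple.
case: (i \in A); last exact: measurable_tnth.
exact: measurableT_comp measurable_opp_tuple (measurable_tnth i).
Qed.

Variables (phi : probability (m.-tuple R) R) (mu : probability Omega R).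
Hypotheses (phi_even : even_measure phi) (phi_null : null_on_hyperplanes phi).
Hypothesis muP : product_law phi mu.

Lemma flip_points_law A S : measurable S -> mu (flip_points A @^-1` S) = mu S.
Proof.
apply: (product_law_pushforward (measurable_flip_points A) (probability_setT mu) muP).
move=> B mB; rewrite /pushforward.
pose B' i := if i \in A then [set e | B i (map_tuple -%R e)] else B i.
have mB' i : measurable (B' i).
  rewrite /B'; case: ifP => // _; rewrite -[X in measurable X]setTI.
  exact: measurable_opp_tuple.
rewrite (_ : _ @^-1` _ = [set x | forall i, B' i (tnth x i)]).
  rewrite [LHS](muP mB'); apply: eq_bigr => i _; rewrite /B'; case: ifP => // _.
  exact: phi_even.
apply/seteqP; split => x /= H i; have := H i; rewrite tnth_mktuple /B';
  by case: (i \in A).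
Qed.

(** The flipped events, one for each subset of [D], are equally likely, and for every single
    configuration at most Cover's number of them occur. *)
Lemma prob_open_halfspace_le D :
  (mu [set x | open_halfspace D (points x)] <=
   ((cover_count #|D| m)%:R / 2 ^+ #|D|)%:E)%E.
Proof.
pose O : set Omega := [set x | open_halfspace D (points x)].
have mO : measurable O := measurable_open_halfspace D.
have mfO A : measurable (flip_points A @^-1` O).
  by rewrite -[X in measurable X]setTI; exact: measurable_flip_points.
have H x : (#|[set A in powerset D | `[< (flip_points A @^-1` O) x >]]%SET|
    <= cover_count #|D| m)%N.
  apply: leq_trans (open_halfspace_flip_count (points x) D).
  apply: subset_leq_card; apply/fintype.subsetP => A; rewrite !finset.inE.
  by rewrite /O /= points_flip.
have := sum_measure_le mu mfO H.
rewrite (eq_bigr (fun=> mu O)) => [|A _]; last exact: flip_points_law.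
have fO : mu O = (fine (mu O))%:E by rewrite fineK // fin_num_measure.
rewrite -/O fO; under eq_bigr do rewrite fO.
rewrite sumEFin !lee_fin sumr_const card_powerset -[leLHS]mulr_natr natrX.
by rewrite ler_pdivlMr // exprn_gt0.
Qed.

(* If [J] does not contain [i0], then the span of [points x i], [i \in J], is
   independent of [points x i0] and contained in a hyperplane. *)
Definition degenerate i0 J : set Omega :=
  [set x | (exists l, ~ in_span J (points x) (delta_mx 0 l)) /\
           in_span J (points x) (points x i0)].

Lemma measurable_degenerate i0 J : measurable (degenerate i0 J).
Proof.
apply: measurableI; last by apply: measurable_in_span => j; exact: measurable_points.
apply: measurable_ex => l; apply: measurableC.
by apply: measurable_in_span => j; exact: measurable_cst.
Qed.

Lemma degenerate_null i0 J : i0 \notin J -> mu (degenerate i0 J) = 0%E.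
Proof.
move=> i0J; apply: (product_law_null (i0 := i0) muP (measurable_degenerate i0 J)) => x.
have pJ e i : i \in J -> points (replace_point i0 (x, e)) i = points x i.
  move=> iJ; rewrite /points tnth_mktuple /=; case: eqP => // ii0.
  by rewrite -ii0 iJ in i0J.
have p0 e : points (replace_point i0 (x, e)) i0 = vec e.
  by rewrite /points tnth_mktuple eqxx.
(* Resampling fixes the points in [J]. A nonzero [u] orthogonal to them gives a null hyperplane that
   must contain the new point; without such [u] they span the whole space, against the first
   condition of [degenerate]. *)
have [[u u0 uJ]|nu] := pselect (exists2 u, u != 0 &
    forall i, i \in J -> dotv u (points x i) = 0); last first.
  rewrite (_ : [set e | _] = set0); first exact: negligible_set0.
  apply/seteqP; split => // e /= [[l nl] _]; apply: nl => u uJ.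
  apply: contrapT => ul; apply: nu; exists u; first by apply/eqP => u0; move: ul; rewrite u0 dotv0l.
  by move=> i iJ; rewrite -(pJ e) // uJ.
exists [set e | \sum_j u 0 j * tnth e j = 0]; split.
- have mf : measurable_fun setT (fun e : m.-tuple R => \sum_j u 0 j * tnth e j).
    apply: measurable_sum => j; apply: measurable_funM; first exact: measurable_cst.
    exact: measurable_tnth.
  rewrite -[X in measurable X]setTI.
  exact: (mf measurableT [set 0] (measurable_set1 0)).
- exact: phi_null.
- move=> e /= [_ /(_ u)]; rewrite p0 => H.
  transitivity (dotv u (vec e)); first by apply: eq_bigr => j _; rewrite mxE.
  by apply: H => i iJ; rewrite pJ // uJ.
Qed.

(** Outside the halfspace case, 0 is a convex combination of points lying weakly on one side of a
    hyperplane. Those with nonzero weight lie on the hyperplane, and one of them is in the span of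
    the others. *)
Lemma not_positively_spansP D x : ~ positively_spans D (points x) ->
  open_halfspace D (points x) \/ exists p : 'I_N * {set 'I_N},
    p.1 \notin p.2 /\ degenerate p.1 p.2 x.
Proof.
move=> nP; have [H|/gordan[c [c0 c1 cx]]] := pselect (open_halfspace D (points x)).
  by left.
right; have [u u0 uD] : exists2 u, u != 0 & forall i, i \in D -> dotv u (points x i) <= 0.
  apply: contrapT => nu; apply: nP => u u0; apply: contrapT => nui; apply: nu.
  by exists u => // i iD; rewrite leNgt; apply/negP => ui; apply: nui; exists i.
have cu i : i \in D -> c i * dotv u (points x i) = 0.
  move=> iD; apply/eqP; rewrite -oppr_eq0; apply/eqP; move: i iD.
  apply: psumr_eq0P => [i iD|]; first by rewrite oppr_ge0 mulr_ge0_le0 ?uD.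
  have := congr1 (dotv u) cx; rewrite dotv_sumr dotv0r sumrN => E.
  by apply/eqP; rewrite oppr_eq0 -[X in _ == X]E; apply/eqP/eq_bigr => i _; rewrite dotvZr.
have [i0 i0D ci0] : exists2 i, i \in D & c i != 0.
  apply: contrapT => nc; move/eqP: c1; rewrite big1 ?[0 == _]eq_sym ?oner_eq0 // => i iD.
  by apply/eqP; apply: contrapT => /negP ci; apply: nc; exists i.
pose J := [set i in D | (i != i0) && (c i != 0)]%SET.
exists (i0, J); split=> [/=|]; first by rewrite !finset.inE eqxx andbF.
have uJ i : i \in J -> dotv u (points x i) = 0.
  rewrite finset.inE => /and3P[iD _ ci]; have /eqP := cu i iD.
  by rewrite mulf_eq0 (negbTE ci) => /eqP.
split=> /=.
  have [l ul] : exists l, u 0 l != 0.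
    apply: contrapT => nl; move/eqP: u0; apply; apply/rowP => l; rewrite mxE.
    by apply/eqP; apply: contrapT => /negP ul; apply: nl; exists l.
  exists l => /(_ u uJ); rewrite dotv_delta => /eqP; exact/negP.
move=> w wJ; have := congr1 (dotv w) cx; rewrite dotv0r dotv_sumr (bigD1 i0) //=.
rewrite big1 => [|i /andP[iD ii0]].
  by rewrite addr0 dotvZr => /eqP; rewrite mulf_eq0 (negbTE ci0) => /eqP.
have [->|ci] := eqVneq (c i) 0; first by rewrite scale0r dotv0r.
by rewrite dotvZr wJ ?mulr0 // finset.inE iD ii0.
Qed.

Lemma prob_not_positively_spans_le D :
  (mu [set x | ~ positively_spans D (points x)] <=
   ((cover_count #|D| m)%:R / 2 ^+ #|D|)%:E)%E.
Proof.
apply: le_trans (prob_open_halfspace_le D).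
pose Bad : set Omega := \big[setU/set0]_(p : 'I_N * {set 'I_N} | p.1 \notin p.2)
  degenerate p.1 p.2.
have mBad : measurable Bad.
  by apply: bigsetU_measurable => p _; exact: measurable_degenerate.
have Bad0 : mu Bad = 0%E.
  apply: measure_negligible => //; apply: (big_ind (fun S => mu.-negligible S)).
  - exact: negligible_set0.
  - by move=> S1 S2; exact: negligibleU.
  - move=> [i J] /= iJ; apply/negligibleP; first exact: measurable_degenerate.
    exact: degenerate_null.
have mO : measurable [set x : Omega | open_halfspace D (points x)].
  exact: measurable_open_halfspace.
have mP : measurable (~` [set x : Omega | positively_spans D (points x)]).
  by apply: measurableC; exact: measurable_positively_spans.
rewrite -[leRHS]adde0 -[X in (_ + X)%E]Bad0.
apply: le_trans (_ : mu ([set x | open_halfspace D (points x)] `|` Bad) <= _)%E.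
  apply: le_measure; rewrite ?inE //; first exact: measurableU.
  move=> x /= /not_positively_spansP[|[p [pJ px]]]; [by left|right].
  rewrite /Bad -bigcup_seq_cond; exists p => //=.
  by rewrite mem_index_enum.
exact: measureU2.
Qed.

End random_points.

(** * Asymptotics of the union bound *)

(** By the symmetry of binomial coefficients the first [r] terms of row N-1 equal the last [r], and
    the two blocks are disjoint when 2r is at most N. *)
Lemma cover_count_half N r : (0 < N)%N -> (2 * r <= N)%N ->
  (2 * cover_count N r <= 2 ^ N)%N.
Proof.
case: N => // n _ rn; rewrite cover_countE mulnA [(2 ^ _)%N]expnS -mulnA leq_pmul2l //.
have -> : (2 ^ n = \sum_(i < n.+1) 'C(n, i))%N.
  by rewrite -[2%N]/(1 + 1)%N Pascal; apply: eq_bigr => i _; rewrite !exp1n !muln1.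
have rn1 : (r <= n.+1)%N by lia.
rewrite (big_ord_widen_cond n.+1 xpredT (fun i => 'C(n, i))) //= mul2n -addnn.
rewrite [X in (X + _)%N](reindex_inj rev_ord_inj) /= big_mkcond.
rewrite [X in (_ + X)%N]big_mkcond -big_split; apply: leq_sum => i _ /=.
have ni : (i <= n)%N by rewrite -ltnS.
rewrite subSS bin_sub //; case: ltnP => H1; case: ltnP => H2; rewrite ?addn0 //.
by lia.
Qed.

Section asymptotics.
Context {R : realType}.

Lemma binomial_term_le (n j : nat) (x y : R) : 0 <= x -> 0 <= y -> (j <= n)%N ->
  'C(n, j)%:R * (x ^+ j * y ^+ (n - j)) <= (x + y) ^+ n.
Proof.
move=> x0 y0 jn; rewrite addrC exprDn.
rewrite (bigD1 (Ordinal (jn : (j < n.+1)%N))) //= mulr_natl mulrC lerDl.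
by apply: sumr_ge0 => i _; rewrite mulrn_wge0 // mulr_ge0 ?exprn_ge0.
Qed.

(** The expansion of [(p1 + (p2 + p3)) ^+ N] controls the choice of the (k+1)-set, that of
    [(p2 + p3) ^+ (N - k.+1)] the Cover sum. Since [p3 <= p2], moving factors from [p3] to [p2] only
    increases a weight, so the weight at N-d-1 serves all smaller indices. *)
Lemma deficit_bound (N d k : nat) (p1 p2 p3 : R) :
  (k < d)%N -> (d < N - 1)%N ->
  0 < p1 -> 0 < p2 -> 0 < p3 -> p1 + (p2 + p3) = 1 -> p3 <= p2 ->
  'C(N, k.+1)%:R * (cover_count (N - k.+1) (N - d - 1))%:R *
    (p1 ^+ k.+1 * (p2 ^+ (d - k) * p3 ^+ (N - d - 1))) <= 2.
Proof.
move=> kd dN p10 p20 p30 psum p32.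
have [n nE] : exists n, (N - k.+1 = n.+1)%N by exists (N - k.+2)%N; lia.
set M := (N - d - 1)%N; have nM : (n.+1 - M = d - k)%N by rewrite -nE /M; lia.
have Mn : (M <= n.+1)%N by rewrite -nE /M; lia.
have H : (\sum_(i < M) 'C(n, i))%:R * (p2 ^+ (d - k) * p3 ^+ M) <= (p2 + p3) ^+ n.+1.
  rewrite exprDn natr_sum mulr_suml.
  rewrite (big_ord_widen_cond n.+2 xpredT
    (fun i => 'C(n, i)%:R * (p2 ^+ (d - k) * p3 ^+ M))) /=; last exact: leqW.
  rewrite big_mkcond /=; apply: ler_sum => i _; case: ifP => iM; last first.
    by rewrite mulrn_wge0 // mulr_ge0 // exprn_ge0 // ltW.
  rewrite -[leRHS]mulr_natl; apply: ler_pM => //.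
  - by rewrite mulr_ge0 // exprn_ge0 // ltW.
  - by rewrite ler_nat; exact: leq_bin2l.
  have -> : (n.+1 - i = (d - k) + (M - i))%N by lia.
  rewrite exprD -mulrA ler_pM2l ?exprn_gt0 //.
  rewrite -[M in leLHS](subnK (ltnW iM)) exprD ler_pM2r ?exprn_gt0 //.
  by apply: lerXn2r; rewrite ?nnegrE // ltW.
rewrite nE cover_countE natrM.
have kN : (k.+1 <= N)%N by lia.
have p23 : 0 <= p2 + p3 by rewrite addr_ge0 // ltW.
have := binomial_term_le (ltW p10) p23 kN; rewrite psum expr1n nE => C1.
move: H C1; set S := _%:R; set B := _%:R; set Q := (p2 + p3) ^+ _.
set x := p1 ^+ _; set y := p2 ^+ _ * _ => H C1.
have -> : B * (2 * S) * (x * y) = 2 * (B * (x * (S * y))) by ring.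
rewrite -[leRHS]mulr1 ler_pM2l //; apply: le_trans C1.
by rewrite ler_wpM2l // ler_wpM2l // exprn_ge0 // ltW.
Qed.

(* Minus the logarithm of the bound on the expected number of missing faces. *)
Definition rate (N d k : nat) (p1 p2 p3 : R) : R :=
  k.+1%:R * ln p1 + (d - k)%:R * ln p2 + (N - d - 1)%:R * ln p3 +
  (N - k.+1)%:R * ln 2.

Lemma deficit_expR (N d k : nat) (p1 p2 p3 : R) :
  (k < d)%N -> (d < N - 1)%N ->
  0 < p1 -> 0 < p2 -> 0 < p3 -> p1 + (p2 + p3) = 1 -> p3 <= p2 ->
  'C(N, k.+1)%:R * ((cover_count (N - k.+1) (N - d - 1))%:R / 2 ^+ (N - k.+1)) <=
  2 * expR (- rate N d k p1 p2 p3).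
Proof.
move=> kd dN p10 p20 p30 psum p32.
have := deficit_bound kd dN p10 p20 p30 psum p32.
rewrite expRN /rate !expRD !expRM_natl !lnK ?posrE // => H.
rewrite ler_pdivlMr ?mulr_gt0 ?exprn_gt0 //.
set X := _ ^+ (N - k.+1); have X0 : X != 0 by rewrite gt_eqF // exprn_gt0.
move: H; set a := p1 ^+ _; set b := p2 ^+ _; set c := p3 ^+ _; set w := (cover_count _ _)%:R.
by apply: le_trans; rewrite le_eqVlt; apply/orP; left; apply/eqP; field.
Qed.

Lemma mul_ln_le (x y : R) : 0 <= x -> 0 < y -> x * ln y - x * ln x <= y - x.
Proof.
rewrite le_eqVlt => /orP[/eqP<-|x0] y0; first by rewrite !mul0r !subr0 ltW.
have : ln (y / x) <= y / x - 1.
  rewrite lerBrDr addrC; apply: le_trans (expR_ge1Dx _) _.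
  by rewrite lnK // posrE divr_gt0.
rewrite -(ler_pM2l x0) ln_div ?posrE // mulrBr mulrBr mulr1.
by rewrite mulrCA divff ?gt_eqF // mulr1.
Qed.

(** The right-hand side is affine in [p], the tangent line of the entropy at [q]; concavity is used
    in this form. *)
Lemma gibbs (p q : R) : 0 <= p <= 1 -> 0 < q < 1 ->
  entropy p <= - p * ln q - (1 - p) * ln (1 - q).
Proof.
move=> /andP[p0 p1] /andP[q0 q1]; rewrite /entropy.
have := mul_ln_le p0 q0.
have := @mul_ln_le (1 - p) (1 - q); rewrite !subr_ge0 subr_gt0 => /(_ p1 q1).
lra.
Qed.

(** The bracket is the limit of [rate / N] for the weights [delta * rho], [delta * (1 - rho)] and
    [1 - delta]. *)
Lemma GfunE (delta rho : R) : 0 < delta < 1 -> 0 < rho < 1 ->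
  Gfun delta rho =
  - (delta * rho * ln (delta * rho) + delta * (1 - rho) * ln (delta * (1 - rho)) +
     (1 - delta) * ln (1 - delta) + (1 - delta * rho) * ln 2).
Proof.
move=> /andP[d0 d1] /andP[r0 r1]; rewrite /Gfun /entropy.
rewrite !lnM ?posrE // ?subr_gt0 //; ring.
Qed.

Lemma below_threshold (delta rho : R) : 2^-1 < delta < 1 -> 0 < rho ->
  rho < rho_S delta ->
  [/\ rho < 1, Gfun delta rho < 0 & 1 - delta <= delta * (1 - rho)].
Proof.
move=> /andP[d2 d1] rho0; have d0 : 0 < delta by lra.
(* In the default case [rho_S delta] would be 0, contradicting [0 < rho]. *)
rewrite /rho_S; case: xgetP => [r _ [/andP[r0 r1] Gr] rr|_]; last by rewrite ltNge ltW.
(* [L] is the tangent line of [Gfun delta] at its zero [r]. It vanishes at [r] and is positive at 1,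
   hence negative to the left of [r]. *)
pose L p := entropy delta + delta * (- p * ln r - (1 - p) * ln (1 - r)) -
  (1 - delta * p) * ln 2.
have GL p : 0 <= p <= 1 -> Gfun delta p <= L p.
  move=> p01; have := gibbs p01 (q := r); rewrite r0 r1 => /(_ isT) H.
  by rewrite /Gfun /L lerD2r lerD2l ler_pM2l.
have Lr : L r = 0 by rewrite -Gr /L /Gfun /entropy.
have L1 : 0 < L 1.
  have := GL 1; rewrite ler01 lexx => /(_ isT); apply: lt_le_trans.
  rewrite /Gfun /entropy subrr ln1 mul0r mulr0 subr0 mulr0 addr0 mulr1.
  have lnd : ln delta < 0 by apply: ln_lt0; rewrite d0.
  have ln1d : ln (1 - delta) < - ln 2.
    by rewrite -lnV ?posrE // ltr_ln ?posrE ?invr_gt0 //; lra.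
  have : 0 < - delta * ln delta by rewrite mulNr oppr_gt0 pmulr_rlt0.
  have : (1 - delta) * ln (1 - delta) < (1 - delta) * - ln 2.
    by rewrite ltr_pM2l // subr_gt0.
  lra.
have Lneg p : 0 <= p -> p < r -> L p < 0.
  move=> p0 pr; have E : (1 - r) * L p + (r - p) * L 1 = (1 - p) * L r.
    by rewrite /L; ring.
  rewrite Lr mulr0 in E; have : 0 < (r - p) * L 1 by rewrite mulr_gt0 // subr_gt0.
  move=> H; have : (1 - r) * L p < 0 by lra.
  by rewrite pmulr_rlt0 // subr_gt0.
have rho1 : rho < 1 by lra.
split => //; first by apply: le_lt_trans (GL _ _) (Lneg _ _ rr); lra.
rewrite leNgt; apply/negP => H.
(* At [q] the weights [delta * (1 - q)] and [1 - delta] coincide. If the inequality failed, [q]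
   would lie below [rho], making [Gfun delta q] negative, but a direct computation shows it is
   non-negative. *)
pose q := (2 * delta - 1) / delta.
have qE : delta * q = 2 * delta - 1 by rewrite /q mulrC divfK // gt_eqF.
have q0 : 0 < q by rewrite divr_gt0 //; lra.
have q1 : q < 1 by rewrite ltr_pdivrMr //; lra.
have qr : q < r.
  apply: lt_trans rr; rewrite -(ltr_pM2l d0) qE; lra.
have : Gfun delta q < 0 by apply: le_lt_trans (GL _ _) (Lneg _ _ qr); lra.
apply/negP; rewrite -leNgt GfunE ?d0 ?d1 ?q0 ?q1 //.
have -> : delta * (1 - q) = 1 - delta by rewrite mulrBr qE; ring.
rewrite qE.
have : (2 * delta - 1) * ln (2 * delta - 1) <= 0.
  by rewrite mulr_ge0_le0 ?ltW ?ln_lt0 //; lra.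
have : (1 - delta) * (ln (1 - delta) + ln 2) <= 0.
  rewrite -lnM ?posrE ?subr_gt0 // mulr_ge0_le0 ?subr_ge0 ?ltW ?ln_lt0 //; lra.
lra.
Qed.

End asymptotics.

(** * The conditioned law and the passage to the limit *)

Lemma measure_bigsetU_le {d} {T : measurableType d} {R : realType}
    (mu : {measure set T -> \bar R}) (I : finType) (D : {set I}) (F : I -> set T) :
  (forall i, measurable (F i)) ->
  (mu (\big[setU/set0]_(i in D) F i) <= \sum_(i in D) mu (F i))%E.
Proof.
move=> mF; suff [] : measurable (\big[setU/set0]_(i in D) F i) /\
  (mu (\big[setU/set0]_(i in D) F i) <= \sum_(i in D) mu (F i))%E by [].
apply: (big_rec2 (fun S s => measurable S /\ (mu S <= s)%E)) => [|i S s _ [mS Ss]].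
  by rewrite measure0.
split; first exact: measurableU.
by apply: le_trans (measureU2 _ _ _) _ => //; exact: leeD2l.
Qed.

Lemma iid_product_law {R : realType} {d d'} {T : measurableType d}
    {E : measurableType d'} {N : nat} (Q : probability T R) (phi : probability E R)
    (Y : {RV Q >-> N.-tuple E}) :
  iid phi Y -> product_law phi (distribution Q Y).
Proof.
move=> [Yphi Yind] A mA; rewrite /distribution /pushforward.
have := Yind [set: 'I_N]%SET A mA.
rewrite (_ : [set w | _] = Y @^-1` [set x | forall i, A i (tnth x i)]); last first.
  by apply/seteqP; split => w /= H i => [|_]; apply: H; rewrite ?finset.inE.
move=> ->; apply: eq_big => [i|i _]; first by rewrite finset.inE.
exact: Yphi.
Qed.

(** Conditioning on an event of probability at least 1/2 at most doubles the failure probability,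
    whence the factor 2. The hypothesis [N <= 2 * d + 2] says that twice the dimension N-d-1 is at
    most N, as [cover_count_half] requires. *)
Lemma gale_diagram_prob {R : realType} {disp} {T : measurableType disp}
    (P : probability T R) (N d k : nat) (phi : probability ((N - d - 1).-tuple R) R)
    (X : {RV P >-> N.-tuple ((N - d - 1).-tuple R)}) :
  (k < d)%N -> (d < N - 1)%N -> (N <= 2 * d + 2)%N ->
  even_measure phi -> null_on_hyperplanes phi -> random_gale_diagram phi X ->
  let p := P [set w | face_number_is k (gale_polytopes (X w)) 'C(N, k.+1)] in
  ((1 - 2 * ('C(N, k.+1)%:R * ((cover_count (N - k.+1) (N - d - 1))%:R /
      2 ^+ (N - k.+1))))%:E <= p <= 1)%E.
Proof.
move=> kd dN N2d phi_even phi_null [d' [T' [Q [Y [Yiid YX]]]]].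
have kN : (k < N)%N := ltn_trans kd (leq_trans dN (leq_subr 1 N)).
set e : R := 'C(N, k.+1)%:R * _.
pose Omega := (N.-tuple ((N - d - 1).-tuple R)).
pose S : set Omega := [set x | forall J : {set 'I_N}, #|J| == k.+1 ->
  positively_spans (~: J) (points x)].
have mS : measurable S.
  apply: measurable_all => J; apply: measurable_imply.
  exact: measurable_positively_spans.
pose B : set Omega := @origin_in_conv R (N - d - 1) N.
have BE : B = ~` [set x | open_halfspace [set: 'I_N] (points x)].
  by apply/seteqP; split => x /origin_in_conv_gordan.
have mO : measurable [set x : Omega | open_halfspace [set: 'I_N] (points x)].
  exact: measurable_open_halfspace.
have mB : measurable B by rewrite BE; apply: measurableC.
rewrite (_ : [set w | _] = X @^-1` S); last first.
  apply/seteqP; split => w /=.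
    by move=> /(face_number_isP _ kN dN) H J /eqP; exact: H.
  by move=> H; apply/(face_number_isP _ kN dN) => J /eqP; exact: H.
rewrite /= probability_le1 ?andbT; last first.
  by rewrite -[X in measurable X]setTI; exact: measurable_funP.
rewrite YX // lee_fin /cond_prob.
pose mu := distribution Q Y.
have muP : product_law phi mu := iid_product_law Yiid.
rewrite -[Q (_ `&` _)]/(mu (S `&` B)) -[Q _]/(mu B).
have muB : 2^-1 <= fine (mu B).
  have -> : mu B = (1 - mu [set x | open_halfspace [set: 'I_N] (points x)])%E.
    by rewrite BE; exact: probability_setC.
  have fO : mu [set x | open_halfspace [set: 'I_N] (points x)] \is a fin_num.
    exact: fin_num_measure.
  have := prob_open_halfspace_le phi_even muP [set: 'I_N]%SET.
  rewrite -[X in (X <= _)%E](fineK fO) lee_fin cardsT card_ord => muO.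
  have H : (cover_count N (N - d - 1))%:R / 2 ^+ N <= 2^-1 :> R.
    rewrite ler_pdivrMr ?exprn_gt0 // ler_pdivlMl // -natrX -natrM ler_nat.
    by apply: cover_count_half; lia.
  rewrite fineB //=; lra.
have muS : fine (mu (~` S)) <= e.
  rewrite -lee_fin fineK ?fin_num_measure //; last exact: measurableC.
  pose D := [set J : {set 'I_N} | #|J| == k.+1]%SET.
  pose F (J : {set 'I_N}) : set Omega := [set x | ~ positively_spans (~: J) (points x)].
  have mF J : measurable (F J).
    by apply: measurableC; exact: measurable_positively_spans.
  apply: le_trans (_ : mu (\big[setU/set0]_(J in D) F J) <= _)%E.
    apply: le_measure; rewrite ?inE //.
    - exact: measurableC.
    - by apply: bigsetU_measurable => J _; exact: mF.
    - move=> x /existsNP[J /not_implyP[Jk nJ]]; rewrite -bigcup_seq_cond; exists J => //=.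
      by rewrite mem_index_enum finset.inE.
  apply: le_trans (measure_bigsetU_le _ _ mF) _.
  apply: le_trans (_ : \sum_(J in D) ((cover_count (N - k.+1) (N - d - 1))%:R /
      2 ^+ (N - k.+1))%:E <= _)%E.
    apply: lee_sum => J; rewrite finset.inE => /eqP Jk.
    have := prob_not_positively_spans_le phi_even phi_null muP (~: J).
    by rewrite cardsCs finset.setCK card_ord Jk.
  by rewrite sumEFin lee_fin sumr_const card_draws card_ord /e -[leLHS]mulr_natl.
have muSB : fine (mu B) - fine (mu (~` S)) <= fine (mu (S `&` B)).
  have : (mu B <= mu (S `&` B) + mu (~` S))%E.
    apply: le_trans (measureU2 _ _ _); [|exact: measurableI|exact: measurableC].
    apply: le_measure; rewrite ?inE //.
      by apply: measurableU; [exact: measurableI|exact: measurableC].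
    by move=> x Bx; have [Sx|nSx] := pselect (S x); [left|right].
  have fS : mu (~` S) \is a fin_num by apply: fin_num_measure; exact: measurableC.
  have fSB : mu (S `&` B) \is a fin_num by apply: fin_num_measure; exact: measurableI.
  have fB : mu B \is a fin_num by exact: fin_num_measure.
  rewrite -(fineK fS) -(fineK fSB) -(fineK fB) -EFinD lee_fin /=; lra.
rewrite ler_pdivlMr; last by lra.
apply: le_trans muSB; move: muB muS.
have : 0 <= fine (mu (~` S)) by rewrite fine_ge0.
set q := fine (mu B); set s := fine (mu (~` S)) => s0 q2 se.
nra.
Qed.

Lemma rate_div {R : realType} (N d k : nat) (p1 p2 p3 : R) :
  (0 < d)%N -> (k < d)%N -> (d < N - 1)%N ->
  rate N d k p1 p2 p3 = N%:R * ((k%:R / d%:R * (d%:R / N%:R) + N%:R^-1) * ln p1 +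
  (d%:R / N%:R - k%:R / d%:R * (d%:R / N%:R)) * ln p2 +
  (1 - d%:R / N%:R - N%:R^-1) * ln p3 +
  (1 - k%:R / d%:R * (d%:R / N%:R) - N%:R^-1) * ln 2).
Proof.
move=> d0 kd dN; have dN' : (d + 1 <= N)%N by lia.
have kN : (k < N)%N by lia.
have Nn0 : N%:R != 0 :> R by rewrite pnatr_eq0 -lt0n (leq_ltn_trans _ kN).
have dn0 : d%:R != 0 :> R by rewrite pnatr_eq0 -lt0n.
rewrite /rate -subnDA !natrB ?natrD -?[k.+1%:R]natr1 //; last exact: ltnW.
by field; rewrite Nn0 dn0.
Qed.

Lemma deficit_cvg {R : realType} (delta rho : R) (k N : nat -> nat) :
  2^-1 < delta < 1 -> 0 < rho -> rho < rho_S delta ->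
  (forall d : nat, (0 < d)%N -> (k d < d)%N /\ (d < N d - 1)%N) ->
  ((d%:R / (N d)%:R : R) @[d --> \oo] --> delta) ->
  (((k d)%:R / d%:R : R) @[d --> \oo] --> rho) ->
  exists K : R, \forall d \near \oo,
    'C(N d, (k d).+1)%:R * ((cover_count (N d - (k d).+1) (N d - d - 1))%:R /
      2 ^+ (N d - (k d).+1)) <= K * harmonic d.
Proof.
move=> delta01 rho0 rho_lt kN dN kd.
have [rho1 G0 p32] := below_threshold delta01 rho0 rho_lt.
have [d2 d1] := andP delta01; have d0 : 0 < delta by lra.
pose p1 := delta * rho; pose p2 := delta * (1 - rho); pose p3 := 1 - delta.
have p10 : 0 < p1 by rewrite mulr_gt0.
have p20 : 0 < p2 by rewrite mulr_gt0 // subr_gt0.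
have p30 : 0 < p3 by rewrite subr_gt0.
have psum : p1 + (p2 + p3) = 1 by rewrite /p1 /p2 /p3; ring.
have N1 : ((N d)%:R^-1 : R) @[d --> \oo] --> (0 : R).
  apply: (squeeze_cvgr _ (cvg_cst (0 : R)) (@cvg_harmonic R)).
  near=> d; have d_gt0 : (0 < d)%N by near: d; exact: nbhs_infty_gt.
  have [_ dNd] := kN d d_gt0; rewrite invr_ge0 ler0n /harmonic /=.
  have dN' : (d < N d)%N := leq_trans dNd (leq_subr 1 _).
  by rewrite lef_pV2 ?posrE ?ltr0n // ?ler_nat ?(leq_ltn_trans _ dN').
have kN' : ((k d)%:R / d%:R * (d%:R / (N d)%:R) : R) @[d --> \oo] --> rho * delta.
  exact: cvgM.
pose l d : R := ((k d)%:R / d%:R * (d%:R / (N d)%:R) + (N d)%:R^-1) * ln p1 +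
  (d%:R / (N d)%:R - (k d)%:R / d%:R * (d%:R / (N d)%:R)) * ln p2 +
  (1 - d%:R / (N d)%:R - (N d)%:R^-1) * ln p3 +
  (1 - (k d)%:R / d%:R * (d%:R / (N d)%:R) - (N d)%:R^-1) * ln 2.
have lcvg : l d @[d --> \oo] --> (rho * delta + 0) * ln p1 + (delta - rho * delta) * ln p2 +
  (1 - delta - 0) * ln p3 + (1 - rho * delta - 0) * ln 2.
  rewrite /l; apply: cvgD; [apply: cvgD; [apply: cvgD|]|].
  - by apply: cvgM; [exact: cvgD|exact: cvg_cst].
  - by apply: cvgM; [exact: cvgB|exact: cvg_cst].
  - by apply: cvgM; [apply: cvgB => //; apply: cvgB => //; exact: cvg_cst|exact: cvg_cst].
  - by apply: cvgM; [apply: cvgB => //; apply: cvgB => //; exact: cvg_cst|exact: cvg_cst].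
have lE d : (0 < d)%N -> rate (N d) d (k d) p1 p2 p3 = (N d)%:R * l d.
  by move=> d_gt0; have [kdd dNd] := kN d d_gt0; exact: rate_div.
have GE : Gfun delta rho < 0 by [].
rewrite GfunE ?rho0 // ?rho1 // in GE; last by rewrite d0.
pose g : R := delta * rho * ln p1 + delta * (1 - rho) * ln p2 +
     (1 - delta) * ln p3 + (1 - delta * rho) * ln 2.
have g0 : 0 < g by rewrite -oppr_lt0.
have lg : l d @[d --> \oo] --> g.
  rewrite (_ : g = (rho * delta + 0) * ln p1 + (delta - rho * delta) * ln p2 +
    (1 - delta - 0) * ln p3 + (1 - rho * delta - 0) * ln 2) //.
  by rewrite /g; ring.
(* [c < g] gives [c < l d] eventually, and [c <= 1] lets the 1 in [1 + x <= expR x] absorb the shift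
   from d to d+1 in [harmonic d]. *)
pose c := Num.min 1 (g / 2).
have c0 : 0 < c by rewrite lt_min ltr01 divr_gt0.
have c1 : c <= 1 by rewrite ge_min lexx.
have cg : c < g by rewrite gt_min; apply/orP; right; lra.
exists (2 / c); near=> d.
have d_gt0 : (0 < d)%N by near: d; exact: nbhs_infty_gt.
have [kdd dNd] := kN d d_gt0.
have ld : c < l d by near: d; exact: (cvgr_gt g lg).
apply: le_trans (deficit_expR kdd dNd p10 p20 p30 psum p32) _.
rewrite -mulrA ler_pM2l // /harmonic /= -invfM expRN lef_pV2 ?posrE ?expR_gt0 //; last first.
  by rewrite mulr_gt0.
apply: le_trans (expR_ge1Dx _); rewrite lE // -natr1.
have : d%:R * c <= (N d)%:R * l d.
  apply: ler_pM => //; first exact: ltW.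
  - by rewrite ler_nat; exact: leq_trans (ltnW dNd) (leq_subr 1 _).
  - exact: ltW.
lra.
Unshelve. all: by end_near.
Qed.

Unset Implicit Arguments.

Theorem theorem1 (R : realType) (delta rho : R) (k N : nat -> nat)
    (phi : forall d : nat, probability ((N d - d - 1).-tuple R) R)
    (disp : nat -> measure_display)
    (T : forall d : nat, measurableType (disp d))
    (P : forall d : nat, probability (T d) R)
    (X : forall d : nat,
       {RV (P d) >-> (N d).-tuple ((N d - d - 1).-tuple R)}) :
  2^-1 < delta < 1 ->
  0 < rho < 1 ->
  (forall d : nat, (0 < d)%N -> (k d < d)%N /\ (d < N d - 1)%N) ->
  ((d%:R / (N d)%:R : R) @[d --> \oo] --> delta) ->
  (((k d)%:R / d%:R : R) @[d --> \oo] --> rho) ->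
  (forall d : nat, (0 < d)%N -> even_measure (phi d)) ->
  (forall d : nat, (0 < d)%N -> null_on_hyperplanes (phi d)) ->
  (forall d : nat, (0 < d)%N -> random_gale_diagram (phi d) (X d)) ->
  rho < rho_S delta ->
  P d [set w | face_number_is (k d) (gale_polytopes (X d w))
                 'C(N d, (k d).+1)] @[d --> \oo] --> 1%E.
Proof.
move=> delta01 /andP[rho0 _] kN dN kd phi_even phi_null XG rho_lt.
have [K HK] := deficit_cvg delta01 rho0 rho_lt kN dN kd.
have lim1 : (1 - 2 * (K * harmonic d))%:E @[d --> \oo] --> (1 : \bar R)%E.
  apply: cvg_EFin; first by near=> d.
  rewrite -[X in _ --> X]subr0; apply: cvgB; first exact: cvg_cst.
  rewrite -(mulr0 2) -[in X in _ --> X](mulr0 K).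
  apply: cvgM; first exact: cvg_cst.
  by apply: cvgM; [exact: cvg_cst|exact: cvg_harmonic].
apply: squeeze_cvge lim1 (cvg_cst 1%E); near=> d.
have d_gt0 : (0 < d)%N by near: d; exact: nbhs_infty_gt.
have [kdd dNd] := kN d d_gt0.
(* Eventually d/N exceeds 1/2, because its limit [delta] does. *)
have N2d : (N d <= 2 * d + 2)%N.
  have : 2^-1 < d%:R / (N d)%:R :> R.
    by near: d; apply: (cvgr_gt _ dN); case/andP: delta01.
  have Nd_gt0 : (0 < N d)%N := ltn_trans d_gt0 (leq_trans dNd (leq_subr 1 _)).
  rewrite ltr_pdivlMr ?ltr0n // mulrC ltr_pdivrMr // -natrM ltr_nat mulnC => /ltnW Nd2.
  exact: leq_trans Nd2 (leq_addr 2 _).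
have /andP[pl p1] := gale_diagram_prob kdd dNd N2d (phi_even d d_gt0)
  (phi_null d d_gt0) (XG d d_gt0).
rewrite p1 andbT; apply: le_trans pl.
rewrite lee_fin lerD2l lerN2 ler_pM2l //.
by near: d.
Unshelve. all: by end_near.
Qed.
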